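(* Let $\Omega$ be a solvable sesquilinear form on $\mathcal{D}$ with respect to an inner product with associated operator $T$. The following statements are equivalent. 1. $\mathcal{D}=D(|T|^{1/2})$, i.e. $\Omega$ is hyper-solvable; 2. $\mathcal{D}\subseteq D(|T|^{1/2})\cap D(|T^*|^{1/2})$; 3. $\mathcal{D}\supseteq D(|T|^{1/2})\cup D(|T^*|^{1/2})$; 4. $\mathcal{D}=D(|T^*|^{1/2})$, i.e. $\Omega^*$ is hyper-solvable.
   Context: $\mathcal{H}$ is a complex Hilbert space with inner product $\langle\cdot,\cdot\rangle$ (linear in the first variable) and norm $\|\cdot\|$; $\mathcal{D}$ is a dense subspace of $\mathcal{H}$; sesquilinear forms are linear in the first and conjugate-linear in the second variable. The adjoint form is $\Omega^*(\xi,\eta)=\overline{\Omega(\eta,\xi)}$, $\xi,\eta\in\mathcal{D}$. A sesquilinear form $\Omega$ on $\mathcal{D}$ is q-closed with respect to a norm $\|\cdot\|_\Omega$ on $\mathcal{D}$ if: (i) there is $\alpha>0$ with $\|\xi\|\le\alpha\|\xi\|_\Omega$ for all $\xi\in\mathcal{D}$; (ii) $\mathcal{E}_\Omega:=(\mathcal{D},\|\cdot\|_\Omega)$ is a reflexive Banach space; (iii) there is $\beta>0$ with $|\Omega(\xi,\eta)|\le\beta\|\xi\|_\Omega\|\eta\|_\Omega$ for all $\xi,\eta\in\mathcal{D}$. Let $\mathcal{E}_\Omega^\times$ be the space of bounded conjugate linear functionals on $\mathcal{E}_\Omega$. $\mathfrak{P}(\Omega)$ is the set of bounded sesquilinear forms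 $\Upsilon$ on $\mathcal{H}$ such that: (1) if $\xi\in\mathcal{D}$ and $(\Omega+\Upsilon)(\xi,\eta)=0$ for all $\eta\in\mathcal{D}$ then $\xi=0$; (2) for every $\Lambda\in\mathcal{E}_\Omega^\times$ there is $\xi\in\mathcal{D}$ with $\Lambda(\eta)=(\Omega+\Upsilon)(\xi,\eta)$ for all $\eta\in\mathcal{D}$. $\Omega$ is solvable (with respect to $\|\cdot\|_\Omega$) if it is q-closed and $\mathfrak{P}(\Omega)\neq\emptyset$; it is solvable with respect to an inner product if $\|\cdot\|_\Omega$ is a Hilbert norm. The operator $T$ associated to a solvable form $\Omega$ is given by: $\xi\in D(T)$ and $T\xi=\chi$ if and only if $\xi\in\mathcal{D}$, $\chi\in\mathcal{H}$ and $\Omega(\xi,\eta)=\langle\chi,\eta\rangle$ for all $\eta\in\mathcal{D}$. It is known that $T$ is closed and densely defined, and that if $\Omega$ is solvable then $\Omega^*$ is solvable with associated operator $T^*$. A solvable form on $\mathcal{D}$ with associated operator $S$ is hyper-solvable if $\mathcal{D}=D(|S|^{1/2})$, where $|S|=(S^*S)^{1/2}$. *)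

(* Defs.v *)
From HB Require Import structures.
From mathcomp Require Import all_boot all_order all_algebra.
From mathcomp Require Export complex.
From mathcomp Require Import all_classical all_reals all_analysis.

Set Implicit Arguments.
Unset Strict Implicit.
Unset Printing Implicit Defensive.

Import Order.TTheory GRing.Theory Num.Theory.
Import numFieldNormedType.Exports.

Local Open Scope classical_set_scope.
Local Open Scope ring_scope.

(* Forms and inner products are linear in the first variable and conjugate
   linear in the second; inner products are mathcomp's {dot V for Num.conj}.
   Norms take values in R[i], as for normedModType R[i]: for z : R[i],
   0 <= z says that z is real and nonnegative. *)
Notation "{ 'sesquilinear' V }" :=
  {bilinear V -> V -> _ | *%R & Num.conj \; *%R}
  (format "{ 'sesquilinear'  V }") : ring_scope.

Notation "{ 'antilinear' V }" := {linear V -> _ | Num.conj \; *%R}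
  (format "{ 'antilinear'  V }") : ring_scope.

Section Subspace.
Context {K : pzRingType} {V : lmodType K}.

Definition subspace_of (D : submodClosed V) := {x : V | x \in D}.

Variable D : submodClosed V.

HB.instance Definition _ := SubType.on (subspace_of D).
HB.instance Definition _ := [Choice of subspace_of D by <:].
HB.instance Definition _ :=
  [SubChoice_isSubLmodule of subspace_of D by <:].

End Subspace.

Section NormedSpaces.
Context {R : realType} {V : lmodType R[i]}.
Implicit Type N : V -> R[i].

Definition is_norm N :=
  [/\ forall x y, N (x + y) <= N x + N y,
      forall a x, N (a *: x) = `|a| * N x
    & forall x, N x = 0 -> x = 0].

Definition norm_complete N :=
  forall u : nat -> V,
    (forall e, 0 < e ->
       exists n0, forall m n, (n0 <= m)%N -> (n0 <= n)%N -> N (u m - u n) < e) ->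
    exists l, forall e, 0 < e ->
       exists n0, forall n, (n0 <= n)%N -> N (u n - l) < e.

Definition bounded_functional N (f : V -> R[i]) :=
  exists C, forall x, `|f x| <= C * N x.

Definition dual N (f : V -> R[i]) :=
  linear_for *%R f /\ bounded_functional N f.

(* Elements of the bidual are maps Phi on functions V -> R[i], of which only
   the values on the dual matter. The dual norm of f is at most M iff
   `|f x| <= M * N x for all x. *)
Definition norm_reflexive N :=
  forall Phi : (V -> R[i]) -> R[i],
    (forall a f g, dual N f -> dual N g ->
       Phi (fun x => a * f x + g x) = a * Phi f + Phi g) ->
    (exists C, forall f M, dual N f -> 0 <= M ->
       (forall x, `|f x| <= M * N x) -> `|Phi f| <= C * M) ->
    exists x, forall f, dual N f -> Phi f = f x.

Definition reflexive_banach N :=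
  [/\ is_norm N, norm_complete N & norm_reflexive N].

Definition hilbert_norm N :=
  is_norm N /\
  exists ip : {dot V for Num.conj}, forall x, N x ^+ 2 = ip x x.

Definition bounded_form N (F : V -> V -> R[i]) :=
  exists2 C, 0 < C & forall x y, `|F x y| <= C * N x * N y.

End NormedSpaces.

Section AdjointForm.
Context {R : realType} {V : lmodType R[i]}.

Definition adjoint_form (F : {sesquilinear V}) (x y : V) : R[i] :=
  Num.conj (F y x).

Variable F : {sesquilinear V}.

Let adjoint_form_bilinear :
  bilinear_for ( *%R : GRing.Scale.law R[i] R[i])
    (Num.conj \; *%R : GRing.Scale.law R[i] R[i]) (adjoint_form F).
Proof.
split=> [y|x] a u v; rewrite /adjoint_form.
- by rewrite linearDr linearZr_LR rmorphD rmorphM /= conjCK.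
- by rewrite linearDl linearZl_LR rmorphD rmorphM.
Qed.

HB.instance Definition _ :=
  bilinear_isBilinear.Build R[i] V V R[i] _ _ (adjoint_form F)
    adjoint_form_bilinear.

End AdjointForm.

(* An operator is represented by its graph; (x, y) \in T means x \in D(T) and
   T x = y. Equality of graphs includes equality of domains. *)
Section Operators.
Context {R : realType} {H : completeNormedModType R[i]}.
Variable inner : {dot H for Num.conj}.
Implicit Types S T : set (H * H).

Definition dom T : set H := [set x | exists y, T (x, y)].

Definition op_comp S T : set (H * H) :=
  [set p | exists2 y, T (p.1, y) & S (y, p.2)].

(* This is the graph of an operator when D(T) is dense. *)
Definition op_adj T : set (H * H) :=
  [set p | forall x y, T (x, y) -> inner y p.1 = inner x p.2].

(* Density of the domain together with S = S^* forces the relation S to be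
   linear and single valued. *)
Definition positive_selfadjoint S :=
  [/\ dense (dom S), op_adj S = S & forall x y, S (x, y) -> 0 <= inner y x].

Definition is_sqrt T S := positive_selfadjoint S /\ op_comp S S = T.

(* The unique positive self-adjoint square root, which exists for T positive
   self-adjoint; the value is junk otherwise. *)
Definition op_sqrt T : set (H * H) := get (is_sqrt T).

Definition op_abs T := op_sqrt (op_comp (op_adj T) T).

End Operators.

Section SolvableForms.
Context {R : realType} {H : completeNormedModType R[i]}.
Variable inner : {dot H for Num.conj}.
Variable D : submodClosed H.
Implicit Types (Omega : {sesquilinear (subspace_of D)}) (N : subspace_of D -> R[i]).

Definition q_closed Omega N :=
  [/\ exists2 a, 0 < a & forall x, `|val x| <= a * N x,
      reflexive_banach N
    & bounded_form N Omega].

Definition perturbations Omega N : set {sesquilinear H} :=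
  [set Upsilon |
    [/\ bounded_form (fun x : H => `|x|) Upsilon,
        forall x, (forall y, Omega x y + Upsilon (val x) (val y) = 0) -> x = 0
      & forall L : {antilinear (subspace_of D)}, bounded_functional N L ->
          exists x, forall y, L y = Omega x y + Upsilon (val x) (val y)]].

Definition solvable_wrt Omega N :=
  q_closed Omega N /\ perturbations Omega N !=set0.

Definition associated_op Omega : set (H * H) :=
  [set p | exists2 x : subspace_of D,
    val x = p.1 & forall y, Omega x y = inner p.2 (val y)].

Definition hyper_solvable Omega :=
  (exists N, solvable_wrt Omega N) /\
  [set` D] = dom (op_sqrt inner (op_abs inner (associated_op Omega))).

End SolvableForms.

(* Main.v *)
Require Import Defs.
From HB Require Import structures.
From mathcomp Require Import all_boot all_order all_algebra.
From mathcomp Require Import all_classical all_reals all_analysis.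
From mathcomp Require Import ring lra.
Import Order.TTheory GRing.Theory Num.Theory.
Import numFieldNormedType.Exports.

(* Since D(|T|) = D(T), the Loewner-Heinz inequality shows that D(|T|^1/2)
   depends only on D(T). So T may be replaced by its bounded perturbation
   T + B associated to a = Omega + Upsilon, which has a bounded inverse K.
   Let W = (K K')^1/2, where ' denotes adjoints, let V = W^-1 K, and let
   Ws = K' V = (K' K)^1/2. With Z = W^1/2 and Zs = Ws^1/2 one gets
   D(|T|^1/2) = ran Z, D(|T'|^1/2) = ran Zs and |Z^-1 K f| = |Zs f|. Because
   a(K f, y) = <f, y>, the Riesz theorem then yields
     ran Z <= D  implies  D <= ran Zs,     D <= ran Z  implies  ran Zs <= D.
   These implications for Omega and for its adjoint form give all the
   equivalences.
   Everything but the last step takes place in real Hilbert spaces: H is viewed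
   with the inner product Re <x, y>, and for a relation that is stable under
   multiplication by i the real and the complex adjoints coincide. *)

Set Implicit Arguments.
Unset Strict Implicit.
Unset Printing Implicit Defensive.

Local Open Scope classical_set_scope.
Local Open Scope ring_scope.

(** * Real Hilbert spaces *)

(** No formula links |T| with the absolute value of T + B; only the domains D(|T|) = D(T) = D(T + B)
    agree, and Loewner-Heinz carries this equality over to the square roots. K = W V is a polar
    decomposition, and Ws = V' W V; this is why |Z^-1 K f| = |Zs f|. The boundedness of the form
    places D in ran Zs; the solvability of the adjoint form yields the reverse inclusion, as it
    turns functionals bounded in the norm of D into elements of D. Each implication compares T with
    T', so both forms are needed to close the circle of statements. In place of a spectral theorem,
    unbounded operators are graphs, self-adjointness is tested by the surjectivity of 1 + S, and
    square roots of bounded operators come from an iteration. Resolvents, projections, values of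
    adjoints and T'T are all obtained from one Riesz theorem for functionals on a subspace that need
    not be closed. *)

Section RealAux.
Variable R : realType.
Implicit Types a b c : R.

Lemma ler_eps a b c : (forall e, 0 < e -> a <= b + e * c) -> a <= b.
Proof.
move=> h; rewrite leNgt; apply/negP => ab.
have := h ((a - b) / (2 * (`|c| + 1))).
have c1 : 0 < `|c| + 1 by rewrite ltr_wpDl.
have ? := ler_norm c.
rewrite divr_gt0 ?subr_gt0 ?mulr_gt0 // => /(_ isT).
set e := _ / _ => hle.
have E : e * (2 * (`|c| + 1)) = a - b.
  by rewrite /e divfK // gt_eqF // mulr_gt0.
have e0 : 0 < e by rewrite divr_gt0 ?subr_gt0 ?mulr_gt0.
have : e * c <= e * `|c| by rewrite ler_pM2l.
nra.
Qed.

Lemma quad_disc a b c :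
  (forall t, 0 <= a + 2 * t * b + t ^+ 2 * c) -> b ^+ 2 <= a * c.
Proof.
move=> h.
have a0 : 0 <= a by have := h 0; rewrite mulr0 mul0r addr0 expr0n mul0r addr0.
have [c0|c0] := eqVneq c 0.
  rewrite c0 mulr0 expr2; have [->|b0] := eqVneq b 0; first by rewrite mul0r.
  have := h (- (a + 1) / (2 * b)); rewrite c0 mulr0 addr0.
  have -> : 2 * (- (a + 1) / (2 * b)) * b = - (a + 1) by field.
  lra.
have := h (- b / c).
have -> : a + 2 * (- b / c) * b + (- b / c) ^+ 2 * c = a - b ^+ 2 / c by field.
have c1 : 0 < c.
  rewrite lt_neqAle eq_sym c0 /=; rewrite leNgt; apply/negP => c1.
  (* Case c < 0. As t (-c) = 2 |b| + a + 1, the quadratic term at [1 + t] outweighs a + 2 (1 + t)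
     b. *)
  have := h ((`|b| * 2 + a + 1 )/ - c).
  set t := _ / _; have tc : t * - c = `|b| * 2 + a + 1 by rewrite /t divfK // oppr_eq0.
  have nb := normr_ge0 b.
  have t0 : 0 < t by rewrite /t divr_gt0 //; lra.
  have := h (1 + t).
  have := ler_norm b; nra.
by rewrite subr_ge0 ler_pdivrMr // mulrC.
Qed.

End RealAux.

(** The inner product is a field over a bare module, so that any carrier (a product, a realified
    space, the form domain) can receive its own. *)
Structure hilbert (R : realType) := Hilbert {
  hilbert_sort :> lmodType R;
  ip : hilbert_sort -> hilbert_sort -> R;
  ipC : forall x y, ip x y = ip y x;
  ipDl : forall x y z, ip (x + y) z = ip x z + ip y z;
  ipZl : forall a x y, ip (a *: x) y = a * ip x y;
  ip_ge0 : forall x, 0 <= ip x x;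
  ip_eq0 : forall x, ip x x = 0 -> x = 0;
  ip_complete : forall u : nat -> hilbert_sort,
    (forall e, 0 < e -> exists n0, forall m n, (n0 <= m)%N -> (n0 <= n)%N ->
       Num.sqrt (ip (u m - u n) (u m - u n)) < e) ->
    exists l, forall e, 0 < e -> exists n0, forall n, (n0 <= n)%N ->
       Num.sqrt (ip (u n - l) (u n - l)) < e }.

Section Hilbert.
Variables (R : realType) (V : hilbert R).
Implicit Types x y z : V.

Definition nm x : R := Num.sqrt (ip x x).

Lemma ipDr x y z : ip x (y + z) = ip x y + ip x z.
Proof. by rewrite !(ipC x) ipDl. Qed.

Lemma ipZr a x y : ip x (a *: y) = a * ip x y.
Proof. by rewrite !(ipC x) ipZl. Qed.

Lemma ipNl x y : ip (- x) y = - ip x y.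
Proof. by rewrite -scaleN1r ipZl mulN1r. Qed.

Lemma ipNr x y : ip x (- y) = - ip x y.
Proof. by rewrite -scaleN1r ipZr mulN1r. Qed.

Lemma ip0l y : ip 0 y = 0 :> R.
Proof. by rewrite -(scale0r (0 : V)) ipZl mul0r. Qed.

Lemma ip0r y : ip y 0 = 0 :> R.
Proof. by rewrite ipC ip0l. Qed.

Definition ipE := (ipDl, ipDr, ipNl, ipNr, ipZl, ipZr, ip0l, ip0r).

Lemma nm_ge0 x : 0 <= nm x.
Proof. exact: sqrtr_ge0. Qed.

Lemma nm2 x : nm x ^+ 2 = ip x x.
Proof. by rewrite sqr_sqrtr // ip_ge0. Qed.

Lemma nm0 : nm 0 = 0.
Proof. by rewrite /nm ip0l sqrtr0. Qed.

Lemma nm_eq0 x : nm x = 0 -> x = 0.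
Proof. by move=> h; apply: ip_eq0; rewrite -nm2 h expr0n. Qed.

Lemma nmZ a x : nm (a *: x) = `|a| * nm x.
Proof.
apply/eqP; rewrite -(@eqrXn2 _ 2) ?mulr_ge0 ?nm_ge0 //.
by rewrite exprMn !nm2 ipZl ipZr real_normK ?num_real // mulrA expr2.
Qed.

Lemma nmN x : nm (- x) = nm x.
Proof. by rewrite /nm ipNl ipNr opprK. Qed.

Lemma nmB x y : nm (x - y) = nm (y - x).
Proof. by rewrite -nmN opprB. Qed.

Lemma cauchy_schwarz x y : `|ip x y| <= nm x * nm y.
Proof.
rewrite -(@ler_pXn2r _ 2) ?nnegrE ?mulr_ge0 ?nm_ge0 //.
rewrite exprMn !nm2 real_normK ?num_real //; apply: quad_disc => t.
have := ip_ge0 (x + t *: y); rewrite !ipE (ipC y x); lra.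
Qed.

Lemma ip_le x y : ip x y <= nm x * nm y.
Proof. exact: le_trans (ler_norm _) (cauchy_schwarz x y). Qed.

Lemma nmD x y : nm (x + y) <= nm x + nm y.
Proof.
rewrite -(@ler_pXn2r _ 2) ?nnegrE ?addr_ge0 ?nm_ge0 //.
rewrite sqrrD !nm2 !ipE (ipC y x); have := ip_le x y; lra.
Qed.

Lemma nmD3 x y z : nm (x - z) <= nm (x - y) + nm (y - z).
Proof. by apply: le_trans (nmD _ _); rewrite addrA subrK. Qed.

Lemma nm_near x y e : nm (x - y) < e -> nm x <= nm y + e.
Proof. by move=> h; have := nmD (x - y) y; rewrite subrK; lra. Qed.

Lemma nm_le_of_ip x C : 0 <= C -> ip x x <= C * nm x -> nm x <= C.
Proof.
move=> C0; rewrite -nm2; have := nm_ge0 x.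
rewrite le_eqVlt => /predU1P[<- //|x0].
by rewrite expr2 ler_pM2r.
Qed.

Definition converges (u : nat -> V) l :=
  forall e, 0 < e -> exists n0, forall n, (n0 <= n)%N -> nm (u n - l) < e.

Lemma complete (u : nat -> V) :
  (forall e, 0 < e -> exists n0, forall m n, (n0 <= m)%N -> (n0 <= n)%N ->
     nm (u m - u n) < e) -> exists l, converges u l.
Proof. exact: ip_complete. Qed.

Lemma complete_le (u : nat -> V) (r : nat -> R) :
  (forall e, 0 < e -> exists n, r n < e) ->
  (forall m n, (n <= m)%N -> nm (u m - u n) <= r n) ->
  exists2 l, converges u l & forall n, nm (u n - l) <= r n.
Proof.
move=> r0 hu; have [|l ul] := complete (u := u).
  move=> e e0; have [n0 hn0] := r0 (e / 2) (divr_gt0 e0 (ltr0Sn _ 1)).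
  exists n0 => m n hm hn; apply: (le_lt_trans (nmD3 _ (u n0) _)).
  by rewrite (nmB (u n0)); have := hu _ _ hm; have := hu _ _ hn; lra.
exists l => // n; apply: (@ler_eps _ _ _ 1) => e e0.
have [n0 hn0] := ul e e0.
have := hn0 (maxn n n0) (leq_maxr _ _); have := hu _ _ (leq_maxl n n0).
have := nmD3 (u n) (u (maxn n n0)) l; rewrite (nmB (u n) (u _)); lra.
Qed.

End Hilbert.

(** * Riesz representation of functionals bounded by the seminorm |j x| *)

Definition linset (R : realType) (E : lmodType R) (G : set E) :=
  G 0 /\ forall a x y, G x -> G y -> G (a *: x + y).

Section Riesz.
Variables (R : realType) (E : lmodType R) (V : hilbert R).
Variables (G : set E) (j : E -> V) (phi : E -> R) (C : R).
Hypotheses (G_lin : linset G) (j_lin : linear j).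
Hypothesis phi_lin : forall a x y, phi (a *: x + y) = a * phi x + phi y.
Hypotheses (C_ge0 : 0 <= C) (phi_le : forall x, G x -> `|phi x| <= C * nm (j x)).

(** If v represents [phi], then J x = |j x - v|^2 - |v|^2, so minimizing [J] means approaching v. *)
Let J x := ip (j x) (j x) - 2 * phi x.

Let J_ge x : G x -> - C ^+ 2 <= J x.
Proof.
move=> Gx; rewrite /J -nm2; have := phi_le Gx; have := ler_norm (phi x).
have := sqr_ge0 (nm (j x) - C); rewrite !expr2; nra.
Qed.

Let JS : set R := [set J x | x in G].

Let JS_inf : has_inf JS.
Proof.
split; first by exists (J 0), 0; [exact: G_lin.1|].
by exists (- C ^+ 2) => _ [x Gx <-]; exact: J_ge.
Qed.

Let d := inf JS.

Let J_ged x : G x -> d <= J x.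
Proof. by move=> Gx; apply: (ge_inf JS_inf.2); exists x. Qed.

Let JD x y t : J (t *: x + y) =
  J y + 2 * t * (ip (j y) (j x) - phi x) + t ^+ 2 * ip (j x) (j x).
Proof. by rewrite /J phi_lin j_lin !ipE (ipC (j x) (j y)); ring. Qed.

(** Parallelogram law: [J] is still at least d at the midpoint of x and y. Hence minimizing
    sequences have Cauchy images. *)
Let par x y : G x -> G y ->
  ip (j x - j y) (j x - j y) <= 2 * (J x + J y - 2 * d).
Proof.
move=> Gx Gy.
have Gm : G ((1/2) *: (x + (-1) *: y) + y).
  apply: G_lin.2 => //; rewrite addrC; exact: G_lin.2.
have := J_ged Gm; rewrite JD /J (addrC x) phi_lin j_lin scaleN1r.
rewrite !ipE (ipC (j x) (j y)); lra.
Qed.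

(* [G] need not be closed: v is the limit in V of the images under j of a
   minimizing sequence of J. *)
Theorem riesz : exists v : V,
  [/\ forall e, 0 < e -> exists2 x, G x & nm (j x - v) < e,
      nm v <= C
    & forall x, G x -> phi x = ip (j x) v].
Proof.
have /choice[u hu] : forall n, exists x, G x /\ J x < d + n.+1%:R^-1.
  move=> n; have n0 : 0 < n.+1%:R^-1 :> R by rewrite invr_gt0.
  by have [_ [x Gx <-] hx] := inf_adherent n0 JS_inf; exists x.
have small e : 0 < e -> exists n0, forall n, (n0 <= n)%N -> n.+1%:R^-1 < e :> R.
  move=> e0; have [n0 _ hn0] := near_infty_natSinv_lt (PosNum e0).
  by exists n0 => n; exact: hn0.
have [|v uv] := complete (u := j \o u).
  move=> e e0; have [|n0 hn0] := small (e ^+ 2 / 4); first by rewrite divr_gt0 ?exprn_gt0.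
  exists n0 => m n hm hn /=.
  rewrite -(@ltr_pXn2r _ 2) ?nnegrE ?nm_ge0 ?(ltW e0) // nm2.
  apply: (le_lt_trans (par (hu m).1 (hu n).1)).
  have := (hu m).2; have := (hu n).2; have := hn0 _ hm; have := hn0 _ hn.
  by move: n.+1%:R^-1 m.+1%:R^-1 => p q; lra.
have near e : 0 < e -> exists n, nm (j (u n) - v) < e /\ n.+1%:R^-1 < e :> R.
  move=> e0; have [n0 h0] := uv _ e0; have [n1 h1] := small _ e0.
  exists (maxn n0 n1); split; first by apply: h0; exact: leq_maxl.
  by apply: h1; exact: leq_maxr.
have rep x : G x -> phi x = ip (j x) v.
  (* First variation: J (t x + u n) >= d with J (u n) close to d leaves 0 <= 2 t b + t^2 |j x|^2 for
     b = <j x, v> - phi x, and [quad_disc] with a = 0 gives b = 0. *)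
  move=> Gx; apply/eqP; rewrite eq_sym -subr_eq0 -sqrf_eq0.
  rewrite eq_le sqr_ge0 andbT; rewrite -(mul0r (ip (j x) (j x))).
  apply: quad_disc => t.
  apply: (@ler_eps _ _ _ (1 + 2 * `|t| * nm (j x))) => e e0.
  have [n [h1 h2]] := near e e0.
  have := J_ged (G_lin.2 t _ _ Gx (hu n).1); rewrite JD.
  have : t * ip (j (u n) - v) (j x) <= `|t| * (e * nm (j x)).
    apply: (le_trans (ler_norm _)); rewrite normrM ler_wpM2l //.
    apply: (le_trans (cauchy_schwarz _ _)); rewrite ler_wpM2r ?nm_ge0 //; lra.
  have : J (u n) < d + e by rewrite (lt_trans (hu n).2) // ltrD2l.
  move: h2 => _; rewrite !ipE (ipC (j x) v); lra.
exists v; split=> //.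
- by move=> e e0; have [n [h1 _]] := near e e0; exists (u n); [exact: (hu n).1|].
- apply: nm_le_of_ip => //; apply: (@ler_eps _ _ _ (C + nm v)) => e e0.
  have [n [h1 _]] := near e e0.
  have := rep _ (hu n).1; have := phi_le (hu n).1; have := ler_norm (phi (u n)).
  have : C * nm (j (u n)) <= C * (nm v + e) by rewrite ler_wpM2l ?nm_near.
  have : ip (v - j (u n)) v <= e * nm v.
    apply: (le_trans (ip_le _ _)); rewrite ler_wpM2r ?nm_ge0 // nmB; exact: ltW.
  rewrite !ipE; lra.
Qed.

End Riesz.

Section Projection.
Variables (R : realType) (V : hilbert R).

Lemma projection (G : set V) (v : V) : linset G ->
  exists2 w, forall e, 0 < e -> exists2 x, G x & nm (x - w) < e
           & forall x, G x -> ip x (v - w) = 0.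
Proof.
move=> Glin.
have [//|a x y||x _|w [h1 _ h2]] := @riesz _ _ V G id (fun x => ip x v) (nm v) Glin.
- by rewrite ipDl ipZl.
- exact: nm_ge0.
- by rewrite mulrC cauchy_schwarz.
by exists w => // x Gx; rewrite !ipE h2 // subrr.
Qed.

Lemma total_dense (G : set V) : linset G ->
  (forall h, (forall x, G x -> ip x h = 0) -> h = 0) ->
  forall v e, 0 < e -> exists2 x, G x & nm (x - v) < e.
Proof.
move=> Glin Gt v e e0; have [w h1 h2] := projection v Glin.
by rewrite (subr0_eq (Gt _ h2)); exact: h1.
Qed.

Lemma dense_total (G : set V) :
  (forall v e, 0 < e -> exists2 x, G x & nm (x - v) < e) ->
  forall h, (forall x, G x -> ip x h = 0) -> h = 0.
Proof.
move=> Gd h hG; apply: nm_eq0; apply/eqP; rewrite eq_le nm_ge0 andbT.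
apply: nm_le_of_ip => //; rewrite mul0r; apply: (@ler_eps _ _ _ (nm h)) => e e0.
have [x Gx hx] := Gd h e e0.
have -> : ip h h = ip (h - x) h by rewrite !ipE (hG x) // subr0.
by rewrite add0r (le_trans (ip_le _ _)) // ler_wpM2r ?nm_ge0 // nmB ltW.
Qed.

Lemma inj_total (A : V -> V) : (forall x y, ip (A x) y = ip x (A y)) ->
  (forall x, A x = 0 -> x = 0) ->
  forall h, (forall x, ip (A x) h = 0) -> h = 0.
Proof.
by move=> As Ai h hA; apply: Ai; apply: ip_eq0; rewrite -As hA.
Qed.

End Projection.

Section Product.
Variables (R : realType) (V W : hilbert R).

Definition prod_ip (p q : V * W) := ip p.1 q.1 + ip p.2 q.2.

Lemma prod_le1 (p : V * W) : nm p.1 <= Num.sqrt (prod_ip p p).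
Proof. by rewrite ler_wsqrtr // lerDl ip_ge0. Qed.

Lemma prod_le2 (p : V * W) : nm p.2 <= Num.sqrt (prod_ip p p).
Proof. by rewrite ler_wsqrtr // lerDr ip_ge0. Qed.

Lemma prod_ge (p : V * W) : Num.sqrt (prod_ip p p) <= nm p.1 + nm p.2.
Proof.
rewrite -(@ler_pXn2r _ 2) ?nnegrE ?addr_ge0 ?nm_ge0 ?sqrtr_ge0 //.
rewrite sqr_sqrtr ?addr_ge0 ?ip_ge0 // /prod_ip -!nm2.
by have := nm_ge0 p.1; have := nm_ge0 p.2; nra.
Qed.

Fact prod_complete (u : nat -> V * W) :
  (forall e, 0 < e -> exists n0, forall m n, (n0 <= m)%N -> (n0 <= n)%N ->
       Num.sqrt (prod_ip (u m - u n) (u m - u n)) < e) ->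
    exists l, forall e, 0 < e -> exists n0, forall n, (n0 <= n)%N ->
       Num.sqrt (prod_ip (u n - l) (u n - l)) < e.
Proof.
move=> hu.
have [|l1 h1] := complete (u := fun n => (u n).1).
  move=> e /hu[n0 h]; exists n0 => m n hm hn.
  exact: (le_lt_trans (prod_le1 (u m - u n)) (h _ _ hm hn)).
have [|l2 h2] := complete (u := fun n => (u n).2).
  move=> e /hu[n0 h]; exists n0 => m n hm hn.
  exact: (le_lt_trans (prod_le2 (u m - u n)) (h _ _ hm hn)).
exists (l1, l2) => e e0; have e2 : 0 < e / 2 by rewrite divr_gt0.
have [n1 k1] := h1 _ e2; have [n2 k2] := h2 _ e2.
exists (maxn n1 n2) => n hn; apply: (le_lt_trans (prod_ge _)) => /=.
have := k1 n (leq_trans (leq_maxl _ _) hn).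
have := k2 n (leq_trans (leq_maxr _ _) hn); lra.
Qed.

(** Kept transparent: carrier and inner product must unfold by conversion, as in [prod_ipE]. *)
Definition hprod : hilbert R.
Proof.
apply: (@Hilbert R (V * W)%type prod_ip) => /=.
- by move=> x y; rewrite /prod_ip ipC (ipC x.2).
- by move=> x y z; rewrite /prod_ip !ipDl; ring.
- by move=> a x y; rewrite /prod_ip !ipZl mulrDr.
- by move=> x; rewrite addr_ge0 ?ip_ge0.
- move=> [x y] /eqP; rewrite paddr_eq0 ?ip_ge0 //= => /andP[/eqP h /eqP k].
  by rewrite (ip_eq0 h) (ip_eq0 k).
- exact: prod_complete.
Defined.

Lemma prod_ipE (p q : V * W) : @ip R hprod p q = ip p.1 q.1 + ip p.2 q.2.
Proof. by []. Qed.

End Product.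

(** * Uniform boundedness and the closed graph theorem *)

Section UniformBoundedness.
Variables (R : realType) (V : hilbert R).

Lemma pow3_small e : 0 < e -> exists n, (3^-1 ^+ n : R) < e.
Proof.
move=> e0; have := @cvg_geometric R 1 3^-1.
rewrite ger0_norm ?invr_ge0 // => /(_ _)/cvgrPdist_lt h.
have [|n _ hn] := h _ e e0; first by lra.
exists n; apply: le_lt_trans (ler_norm _) _.
by have := hn n (leqnn n); rewrite /geometric /= !mul1r sub0r normrN.
Qed.

(* Gliding hump (Sokal): the signs in [x (n+1) = x n +- 3^-n w n / |w n|] are
   chosen so that [|<x (n+1), w n>| >= 3^-n |w n|], and the tail of the series
   destroys at most half of it. *)
Theorem uniform_boundedness (B : set V) :
  (forall x, exists M, forall w, B w -> `|ip x w| <= M) ->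
  exists2 C, 0 <= C & forall w, B w -> nm w <= C.
Proof.
move=> Bpt; apply: contrapT => hB.
have /choice[w hw] : forall n, exists w, B w /\ 4 ^+ n < nm w.
  move=> n; apply: contrapT => hn; apply: hB; exists (4 ^+ n); first exact: exprn_ge0.
  by move=> w Bw; rewrite leNgt; apply/negP => h; apply: hn; exists w.
have w0 n : 0 < nm (w n) by rewrite (le_lt_trans _ (hw n).2) ?exprn_ge0.
pose st n x : V := (if 0 <= ip x (w n) then 1 else -1) * 3^-1 ^+ n / nm (w n) *: w n.
pose fix x n : V := if n is k.+1 then x k + st k (x k) else 0.
have p3 n : 0 <= (3^-1 ^+ n : R) by rewrite exprn_ge0 ?invr_ge0.
have st_nm n y : nm (st n y) = 3^-1 ^+ n.
  rewrite nmZ !normrM normfV (ger0_norm (nm_ge0 _)) divfK ?gt_eqF //.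
  by rewrite (ger0_norm (p3 n)); case: ifP; rewrite ?normrN normr1 mul1r.
have st_ip n y : 3^-1 ^+ n * nm (w n) <= `|ip (y + st n y) (w n)|.
  rewrite ipDl ipZl -nm2 expr2 mulrA divfK ?gt_eqF //.
  have h0 : 0 <= 3^-1 ^+ n * nm (w n) by rewrite mulr_ge0 ?nm_ge0.
  case: ifP => [h|/negbT]; first by rewrite mul1r ger0_norm ?lerDr // addr_ge0.
  rewrite -ltNge => h; rewrite mulN1r mulNr ler0_norm; lra.
have tail m n : (n <= m)%N -> nm (x m - x n) <= 3/2 * (3^-1 ^+ n - 3^-1 ^+ m).
  move=> /subnKC <-; elim: (m - n)%N => [|k IH].
    by rewrite addn0 !subrr nm0 mulr0.
  rewrite addnS /= exprS; apply: (le_trans (nmD3 _ (x (n + k)%N) _)).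
  by rewrite (addrC (x _) (st _ _)) addrK st_nm; move: IH; lra.
have [||l _ hl] := @complete_le _ V x (fun n => 3/2 * 3^-1 ^+ n).
- move=> e e0; have [|n hn] := @pow3_small (2/3 * e); first by lra.
  by exists n; lra.
- by move=> m n /tail; have := p3 m; lra.
have [M hM] := Bpt l.
(* The tail past n + 1 is at most 3/2 * 3^-(n+1) = 3^-n / 2, so |<l, w n>| >= 3^-n |w n| / 2, while
   |w n| > 4^n. *)
have lb n : (4/3) ^+ n / 2 < M.
  have h1 := st_ip n (x n); have h2 := hl n.+1; have h3 := hM _ (hw n).1.
  have h4 := cauchy_schwarz (x n.+1 - l) (w n).
  have h5 : `|ip (x n.+1) (w n)| <= `|ip (x n.+1 - l) (w n)| + `|ip l (w n)|.
    by have := ler_normD (ip (x n.+1 - l) (w n)) (ip l (w n)); rewrite -ipDl subrK.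
  have h6 : nm (x n.+1 - l) * nm (w n) <= (1/2) * 3^-1 ^+ n * nm (w n).
    by rewrite ler_wpM2r ?nm_ge0 //; move: h2; rewrite exprS; lra.
  have h7 : 3^-1 ^+ n * 4 ^+ n < 3^-1 ^+ n * nm (w n).
    by rewrite ltr_pM2l ?exprn_gt0 ?invr_gt0 // (hw n).2.
  have h8 : (4/3) ^+ n = 3^-1 ^+ n * 4 ^+ n :> R by rewrite -exprMn; congr (_ ^+ _); lra.
  by move: h1; rewrite -/(x n.+1); lra.
have lb2 n : 1 + n%:R / 3 <= (4/3) ^+ n :> R.
  elim: n => [|n IH]; first by rewrite mul0r addr0 expr0.
  by rewrite exprS -natr1; have : 0 <= n%:R :> R by []; lra.
have := archi_boundP (normr_ge0 (6 * M)); move: (Num.bound _) => k hk.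
by have := lb k; have := lb2 k; have := ler_norm (6 * M); lra.
Qed.

End UniformBoundedness.

Section ClosedGraph.
Variables (R : realType) (V W : hilbert R) (L : V -> W).
Hypothesis L_lin : linear L.

(* The adjoint of L is densely defined, and it maps the unit ball of its domain
   to a set that is weakly bounded, hence bounded. *)
Theorem closed_graph :
  (forall x y, (forall e, 0 < e -> exists2 z, nm (z - x) < e & nm (L z - y) < e) ->
     y = L x) ->
  exists2 C, 0 <= C & forall x, nm (L x) <= C * nm x.
Proof.
move=> Lclosed.
pose DL : set W := [set w | exists v, forall x, ip (L x) w = ip x v].
have L0 : L 0 = 0 by have := L_lin (-1) 0 0; rewrite scaler0 addr0 scaleN1r addNr.
have DLlin : linset DL.
  split; first by exists 0 => x; rewrite !ip0r.
  move=> a w w' [v hv] [v' hv']; exists (a *: v + v') => x.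
  by rewrite !ipE hv hv'.
have DLdense : forall w e, 0 < e -> exists2 d, DL d & nm (d - w) < e.
  apply: total_dense => // h hDL.
  (* Riesz on the graph of L: (u, v) lies in its closure, so v = L u, and the adjoint of L maps h -
     v to u. Then <h - v, h> = 0 gives |h - v|^2 = - |u|^2, whence u = 0 and h = v = 0. *)
  have [||||x _|[u v] [adh _ rep]] := @riesz R V (hprod V W) setT (fun x => (x, L x))
     (fun x => ip (L x) h) (nm h).
  - by split.
  - by move=> a x y; rewrite L_lin.
  - by move=> a x y; rewrite L_lin ipDl ipZl.
  - exact: nm_ge0.
  - rewrite mulrC (le_trans (cauchy_schwarz _ _)) // ler_wpM2r ?nm_ge0 //.
    exact: (prod_le2 (x, L x)).
  have vE : v = L u.
    apply: Lclosed => e e0; have [x _ hx] := adh e e0; exists x.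
    - exact: (le_lt_trans (prod_le1 ((x, L x) - (u, v))) hx).
    - exact: (le_lt_trans (prod_le2 ((x, L x) - (u, v))) hx).
  have Du : DL (h - v).
    by exists u => x; rewrite !ipE (rep x I) prod_ipE addrK.
  have h1 := hDL _ Du; have h2 := rep u I.
  rewrite prod_ipE /= -vE in h2.
  have v0 : h - v = 0.
    apply: ip_eq0; move: h1; rewrite !ipE => h1.
    have := ip_ge0 u; have := ip_ge0 (h - v); rewrite !ipE (ipC h v).
    lra.
  have u0 : u = 0.
    apply: ip_eq0; move: h1; rewrite v0 ip0l => _.
    move: h2; rewrite -(subr0_eq v0); lra.
  by rewrite (subr0_eq v0) vE u0.
have [|C C0 hC] := @uniform_boundedness R V
    [set v | exists w, nm w <= 1 /\ forall x, ip (L x) w = ip x v].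
  move=> x; exists (nm (L x)) => v [w [w1 hw]]; rewrite -hw.
  by rewrite (le_trans (cauchy_schwarz _ _)) // ler_piMr ?nm_ge0.
have key w x : DL w -> ip (L x) w <= C * nm x * nm w.
  move=> [v hv]; rewrite hv.
  have [w0|w0] := eqVneq (nm w) 0.
    by rewrite -hv (nm_eq0 w0) ip0r nm0 mulr0.
  have n0 : 0 < nm w by rewrite lt_neqAle eq_sym w0 nm_ge0.
  have : nm ((nm w)^-1 *: v) <= C.
    apply: hC; exists ((nm w)^-1 *: w); split; last by move=> y; rewrite !ipZr hv.
    by rewrite nmZ normfV (ger0_norm (nm_ge0 _)) mulVf.
  rewrite nmZ normfV (ger0_norm (nm_ge0 _)) mulrC ler_pdivrMr // => hv2.
  apply: (le_trans (ip_le _ _)).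
  by rewrite mulrAC mulrC ler_wpM2r ?nm_ge0.
exists C => // x; apply: nm_le_of_ip; first by rewrite mulr_ge0 ?nm_ge0.
apply: (@ler_eps _ _ _ (C * nm x + nm (L x))) => e e0.
have [w Dw hw] := DLdense (L x) e e0.
have h1 := key w x Dw.
have h2 : C * nm x * nm w <= C * nm x * (nm (L x) + e).
  by rewrite ler_wpM2l ?mulr_ge0 ?nm_ge0 // nm_near.
have h3 : ip (L x) (L x - w) <= nm (L x) * e.
  by rewrite (le_trans (ip_le _ _)) // ler_wpM2l ?nm_ge0 // nmB ltW.
move: h3; rewrite !ipE; lra.
Qed.

End ClosedGraph.

(** * Bounded operators *)

Section LinearMaps.
Variables (R : realType) (U W : lmodType R) (A : U -> W).
Hypothesis Al : linear A.

Lemma lin0 : A 0 = 0.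
Proof. by have := Al (-1) 0 0; rewrite scaler0 addr0 scaleN1r addNr. Qed.

Lemma linD x y : A (x + y) = A x + A y.
Proof. by have := Al 1 x y; rewrite !scale1r. Qed.

Lemma linZ a x : A (a *: x) = a *: A x.
Proof. by have := Al a x 0; rewrite !addr0 lin0 addr0. Qed.

Lemma linB x y : A (x - y) = A x - A y.
Proof. by rewrite linD -(scaleN1r y) linZ scaleN1r. Qed.

End LinearMaps.

Definition bounded_op (R : realType) (U W : hilbert R) (A : U -> W) :=
  exists2 M, 0 <= M & forall x, nm (A x) <= M * nm x.

(** * Positive bounded operators and their square roots *)

Section BoundedOperators.
Variables (R : realType) (V : hilbert R).
Implicit Types (A B C : V -> V) (x y : V).

(** Symmetry on the whole space yields linearity and boundedness ([sym_linear], [sym_bounded]), so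
    these two fields describe a bounded positive operator. *)
Record positive_op A : Prop := PositiveOp {
  pos_sym : forall x y, ip (A x) y = ip x (A y);
  pos_ge0 : forall x, 0 <= ip (A x) x }.

Lemma ip_inj x y : (forall z, ip x z = ip y z) -> x = y.
Proof.
by move=> h; apply/subr0_eq; apply: ip_eq0; rewrite ipDl ipNl h subrr.
Qed.

Lemma sym_linear A : (forall x y, ip (A x) y = ip x (A y)) -> linear A.
Proof. by move=> As a x y; apply: ip_inj => z; rewrite As !ipE !As. Qed.

(** Hellinger-Toeplitz: <A w, z> = <w, A z> passes to the limit in w, so the graph is closed. *)
Lemma sym_bounded A : (forall x y, ip (A x) y = ip x (A y)) -> bounded_op A.
Proof.
move=> As; apply: closed_graph; first exact: sym_linear.
move=> x y adh; apply: ip_inj => z; rewrite As.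
apply/eqP; rewrite -subr_eq0 -normr_le0.
apply: (@ler_eps _ _ _ (nm z + nm (A z))) => e /adh[w h1 h2].
have -> : ip y z - ip x (A z) = ip (y - A w) z + ip (w - x) (A z).
  by rewrite !ipE As; ring.
rewrite add0r mulrDr; apply: (le_trans (ler_normD _ _)).
by rewrite lerD // (le_trans (cauchy_schwarz _ _)) // ler_wpM2r ?nm_ge0 // ltW // nmB.
Qed.

Lemma psd_cs A x y : positive_op A ->
  ip (A x) y ^+ 2 <= ip (A x) x * ip (A y) y.
Proof.
move=> [As A0]; apply: quad_disc => t.
have Al := sym_linear As; have := A0 (x + t *: y).
rewrite (linD Al) (linZ Al) !ipE (ipC (A y) x) -As; lra.
Qed.

(** [psd_cs] with y = A x gives |A x|^4 <= |x|^2 |A x|^2. *)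
Lemma pos_contraction A : positive_op A -> (forall x, ip (A x) x <= ip x x) ->
  forall x, nm (A x) <= nm x.
Proof.
move=> Ap A1 x; rewrite -(@ler_pXn2r _ 2) ?nnegrE ?nm_ge0 // !nm2.
have := ip_ge0 (A x); rewrite le_eqVlt => /predU1P[<-|h]; first exact: ip_ge0.
rewrite -(ler_pM2r h) -expr2 (le_trans (psd_cs x (A x) Ap)) //.
by rewrite ler_pM ?(pos_ge0 Ap).
Qed.

Section SquareRootIteration.
Variable B : V -> V.
Hypotheses (B_sym : forall x y, ip (B x) y = ip x (B y)).
Hypothesis B_le : forall x, nm (B x) <= nm x.

(* [sqit n] converges to a solution Y of Y = (B + Y^2) / 2, that is, to
   1 - (1 - B)^1/2; for B = 1, [sqbd n] is the same iteration and tends to 1. *)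
Fixpoint sqit n x : V :=
  if n is k.+1 then 2^-1 *: (B x + sqit k (sqit k x)) else 0.

Fixpoint sqbd n : R := if n is k.+1 then (1 + sqbd k ^+ 2) / 2 else 0.

Lemma sqbd_bounds n : 0 <= sqbd n <= 1.
Proof.
elim: n => [|n /andP[h1 h2]] /=; first by rewrite lexx ler01.
by apply/andP; split; nra.
Qed.

(** For s = 1 - [sqbd n] the recursion reads s' = s (1 - s / 2), which decays like 2 / n. *)
Lemma sqbd_rate n : (1 - sqbd n) * (n%:R + 2) <= 2.
Proof.
elim: n => [|n] /=; first by rewrite subr0 add0r mul1r.
rewrite -[n.+1%:R]natr1; have : 0 <= n%:R :> R by [].
have /andP[] := sqbd_bounds n; move: (sqbd n) (n%:R) => t k t0 t1 k0 h.
have : 0 <= (2 - (1 - t) * (k + 2)) * (1 - (1 - t) / 2).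
  by apply: mulr_ge0; lra.
have := sqr_ge0 (1 - t); lra.
Qed.

Lemma sqbd_small e : 0 < e -> exists n, 1 - sqbd n < e.
Proof.
move=> e0; have := archi_boundP (normr_ge0 (2 / e)); move: (Num.bound _) => n hn.
exists n; have /andP[_ h1] := sqbd_bounds n; have := sqbd_rate n.
have : 2 < n%:R * e by rewrite -ltr_pdivrMr // (le_lt_trans (ler_norm _)).
have : 0 <= n%:R :> R by []; nra.
Qed.

Lemma sqbd_lim a c : 0 <= c -> (forall n, a <= (1 - sqbd n) * c) -> a <= 0.
Proof.
move=> c0 h; apply: (@ler_eps _ _ _ c) => e /sqbd_small[n hn].
by rewrite add0r (le_trans (h n)) // ler_wpM2r // ltW.
Qed.

Lemma sqit_sym n x y : ip (sqit n x) y = ip x (sqit n y).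
Proof.
elim: n x y => [|n IH] x y /=; first by rewrite ip0l ip0r.
by rewrite !ipE B_sym !IH.
Qed.

(** [sqit n] is a polynomial in B. *)
Lemma sqit_comm C n x : linear C -> (forall x, C (B x) = B (C x)) ->
  C (sqit n x) = sqit n (C x).
Proof.
move=> Cl CB; elim: n x => [|n IH] x /=; first exact: lin0.
by rewrite (linZ Cl) (linD Cl) CB !IH.
Qed.

Lemma sqitC m n x : sqit m (sqit n x) = sqit n (sqit m x).
Proof.
have l k : linear (sqit k) by apply: sym_linear => ? ?; exact: sqit_sym.
apply: sqit_comm => // y; symmetry; apply: sqit_comm => //.
exact: sym_linear.
Qed.

Lemma sqit_le n x : nm (sqit n x) <= sqbd n * nm x.
Proof.
elim: n x => [|n IH] x /=; first by rewrite nm0 mul0r.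
rewrite nmZ gtr0_norm ?invr_gt0 //.
have /andP[h0 _] := sqbd_bounds n.
have := nmD (B x) (sqit n (sqit n x)); have := B_le x.
have := IH (sqit n x); have : sqbd n * nm (sqit n x) <= sqbd n * (sqbd n * nm x).
  by rewrite ler_wpM2l.
lra.
Qed.

(** The iterates commute, so Y_(n+2) - Y_(n+1) = (Y_(n+1) + Y_n) (Y_(n+1) - Y_n) / 2. The scalar
    iteration factors in the same way and therefore dominates. *)
Lemma sqit_step n x :
  nm (sqit n.+1 x - sqit n x) <= (sqbd n.+1 - sqbd n) * nm x.
Proof.
elim: n x => [|n IH] x; first by rewrite !subr0; exact: sqit_le.
have l k : linear (sqit k) by apply: sym_linear => ? ?; exact: sqit_sym.
set d := sqit n.+1 x - sqit n x.
have -> : sqit n.+2 x - sqit n.+1 x = 2^-1 *: (sqit n.+1 d + sqit n d).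
  rewrite [sqit n.+2 x]/(2^-1 *: (B x + sqit n.+1 (sqit n.+1 x))).
  rewrite [in X in _ - X]/sqit -/sqit -scalerBr; congr (_ *: _).
  rewrite !(linB (l _)) (sqitC n n.+1) addrA subrK.
  by rewrite opprD addrACA subrr add0r.
rewrite nmZ gtr0_norm ?invr_gt0 //.
have /andP[h0 _] := sqbd_bounds n; have /andP[h1 _] := sqbd_bounds n.+1.
have := nmD (sqit n.+1 d) (sqit n d).
have := sqit_le n.+1 d; have := sqit_le n d.
have : sqbd n.+1 * nm d <= sqbd n.+1 * ((sqbd n.+1 - sqbd n) * nm x).
  by rewrite ler_wpM2l ?IH.
have : sqbd n * nm d <= sqbd n * ((sqbd n.+1 - sqbd n) * nm x).
  by rewrite ler_wpM2l ?IH.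
have -> : sqbd n.+2 - sqbd n.+1 = 2^-1 * (sqbd n.+1 + sqbd n) * (sqbd n.+1 - sqbd n).
  have e2 : sqbd n.+2 = (1 + sqbd n.+1 ^+ 2) / 2 by [].
  have e1 : sqbd n.+1 = (1 + sqbd n ^+ 2) / 2 by [].
  by rewrite e2; move: e1; move: (sqbd n.+1) (sqbd n) => u v; lra.
lra.
Qed.

Lemma sqit_cauchy m n x : (n <= m)%N ->
  nm (sqit m x - sqit n x) <= (sqbd m - sqbd n) * nm x.
Proof.
move=> /subnKC <-; elim: (m - n)%N => [|k IH].
  by rewrite addn0 !subrr nm0 mul0r.
rewrite addnS; apply: (le_trans (nmD3 _ (sqit (n + k)%N x) _)).
have := sqit_step (n + k)%N x; move: IH; lra.
Qed.

Lemma sqit_limit : exists Y : V -> V,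
  forall n x, nm (sqit n x - Y x) <= (1 - sqbd n) * nm x.
Proof.
suff /choice[Y hY] : forall x, exists y, forall n,
    nm (sqit n x - y) <= (1 - sqbd n) * nm x by exists Y => n x; exact: hY.
move=> x; have [||l _ hl] := @complete_le _ V (sqit^~ x) (fun n => (1 - sqbd n) * nm x).
- move=> e e0; have x1 : 0 < nm x + 1 by rewrite ltr_wpDl ?nm_ge0.
  have [|n hn] := @sqbd_small (e / (nm x + 1)); first exact: divr_gt0.
  exists n; rewrite ltr_pdivlMr // in hn; apply: le_lt_trans hn.
  by rewrite ler_wpM2l ?lerDl // subr_ge0; have /andP[] := sqbd_bounds n.
- move=> m n /sqit_cauchy h; apply: (le_trans (h x)).
  by rewrite ler_wpM2r ?nm_ge0 // lerD2r; have /andP[] := sqbd_bounds m.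
by exists l.
Qed.

End SquareRootIteration.

(** With B = 1 - A, the limit Y solves 2 Y = B + Y^2, so (1 - Y)^2 = 1 - B = A; and 1 - Y is
    positive because |Y x| <= |x|. *)
Lemma contraction_sqrt A : positive_op A -> (forall x, ip (A x) x <= ip x x) ->
  exists Z, [/\ positive_op Z, forall x, Z (Z x) = A x
    & forall C, linear C -> bounded_op C -> (forall x, C (A x) = A (C x)) ->
        forall x, C (Z x) = Z (C x)].
Proof.
move=> Ap A1; have Al := sym_linear (pos_sym Ap).
pose B x := x - A x.
have Bs x y : ip (B x) y = ip x (B y) by rewrite !ipE (pos_sym Ap).
have Bl : linear B by exact: sym_linear.
have Ble : forall x, nm (B x) <= nm x.
  apply: pos_contraction; first split => // x; rewrite ?ipE.
  - by rewrite subr_ge0.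
  - by move=> x; rewrite !ipE gerBl (pos_ge0 Ap).
have [Y hY] := sqit_limit Bs Ble.
have Bt n := sqbd_bounds n.
have lY n : linear (sqit B n) by apply: sym_linear => ? ?; exact: sqit_sym.
have Ys x y : ip (Y x) y = ip x (Y y).
  apply/eqP; rewrite -subr_eq0 -normr_le0.
  apply: (@sqbd_lim _ (2 * (nm x * nm y))) => [|n].
    by rewrite !mulr_ge0 ?nm_ge0.
  have -> : ip (Y x) y - ip x (Y y) =
      ip (Y x - sqit B n x) y - ip x (Y y - sqit B n y).
    by rewrite !ipE (sqit_sym Bs); ring.
  apply: (le_trans (ler_normB _ _)).
  have := cauchy_schwarz (Y x - sqit B n x) y.
  have := cauchy_schwarz x (Y y - sqit B n y); rewrite !(nmB (Y _)).
  have : nm (sqit B n x - Y x) * nm y <= (1 - sqbd n) * nm x * nm y.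
    by rewrite ler_wpM2r ?nm_ge0.
  have : nm x * nm (sqit B n y - Y y) <= nm x * ((1 - sqbd n) * nm y).
    by rewrite ler_wpM2l ?nm_ge0.
  lra.
have Yl : linear Y by exact: sym_linear.
have Yle x : nm (Y x) <= nm x.
  rewrite -subr_le0; apply: (@sqbd_lim _ (nm x)) => [|n]; first exact: nm_ge0.
  have := nmD3 (Y x) (sqit B n x) 0; rewrite !subr0 nmB.
  have := sqit_le Ble n x; have /andP[_ t1] := Bt n.
  have : sqbd n * nm x <= 1 * nm x by rewrite ler_wpM2r ?nm_ge0.
  have := hY n x; lra.
have Yeq x : 2 *: Y x = B x + Y (Y x).
  apply/subr0_eq/nm_eq0/eqP; rewrite eq_le nm_ge0 andbT.
  apply: (@sqbd_lim _ (2 * nm x + nm x + nm (Y x))) => [|n].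
    by have := nm_ge0 x; have := nm_ge0 (Y x); lra.
  have -> : 2 *: Y x - (B x + Y (Y x)) =
     2 *: (Y x - sqit B n.+1 x) + (sqit B n (sqit B n x - Y x)
       + (sqit B n (Y x) - Y (Y x))).
    rewrite /= scalerBr scalerA divff ?pnatr_eq0 // scale1r (linB (lY n)).
    move: (2 *: Y x) (B x) (Y (Y x)) (sqit B n _) (sqit B n (Y x)) => p b w s u.
    by rewrite (addrA (s - u)) subrK !opprD !addrA subrK.
  apply: (le_trans (nmD _ _)); rewrite nmZ gtr0_norm // nmB.
  have := nmD (sqit B n (sqit B n x - Y x)) (sqit B n (Y x) - Y (Y x)).
  have := hY n x; have := hY n (Y x); have := hY n.+1 x.
  have := sqit_le Ble n (sqit B n x - Y x); have /andP[t0 t1] := Bt n.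
  have : sqbd n * nm (sqit B n x - Y x) <= 1 * nm (sqit B n x - Y x).
    by rewrite ler_wpM2r ?nm_ge0.
  have : (1 - sqbd n.+1) * nm x <= (1 - sqbd n) * nm x.
    by rewrite ler_wpM2r ?nm_ge0 //=; nra.
  lra.
exists (fun x => x - Y x); split.
- split=> x; first by move=> y; rewrite !ipE Ys.
  rewrite !ipE subr_ge0 (le_trans (ip_le _ _)) // -nm2 expr2.
  by rewrite ler_wpM2r ?nm_ge0.
- move=> x; rewrite (linB Yl).
  have <- : x - B x = A x by rewrite /B opprB addrC subrK.
  have -> : B x = 2 *: Y x - Y (Y x) by rewrite Yeq addrK.
  rewrite !opprB scaler_nat mulr2n opprD; move: (Y x) (Y (Y x)) => p q.
  by rewrite (addrCA q) -(addrA x).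
- move=> C Cl [M M0 CM] CA x; rewrite (linB Cl); congr (_ - _).
  apply/subr0_eq/nm_eq0/eqP; rewrite eq_le nm_ge0 andbT.
  apply: (@sqbd_lim _ (M * nm x + nm (C x))) => [|n].
    by rewrite addr_ge0 ?mulr_ge0 ?nm_ge0.
  apply: (le_trans (nmD3 _ (C (sqit B n x)) _)).
  rewrite -(linB Cl) [X in _ + nm (X - _)]sqit_comm //; last first.
    by move=> y; rewrite /B (linB Cl) CA.
  have := CM (Y x - sqit B n x); have := hY n (C x).
  have : M * nm (Y x - sqit B n x) <= M * ((1 - sqbd n) * nm x).
    by rewrite ler_wpM2l // nmB.
  lra.
Qed.

(** A / (M + 1) satisfies [contraction_sqrt] when |A x| <= M |x|; the added 1 keeps the divisor
    positive. The commutation clause serves [comm_pos] and [psa_sqrt]. *)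
Theorem positive_sqrt A : positive_op A ->
  exists Z, [/\ positive_op Z, forall x, Z (Z x) = A x
    & forall C, linear C -> bounded_op C -> (forall x, C (A x) = A (C x)) ->
        forall x, C (Z x) = Z (C x)].
Proof.
move=> Ap; have [M M0 AM] := sym_bounded (pos_sym Ap).
pose m := M + 1; have m0 : 0 < m by rewrite ltr_wpDl.
have Al := sym_linear (pos_sym Ap).
have [||Z [Zp ZZ ZC]] := @contraction_sqrt (fun x => m^-1 *: A x).
- split=> x; first by move=> y; rewrite !ipE (pos_sym Ap).
  by rewrite ipZl mulr_ge0 ?invr_ge0 ?(pos_ge0 Ap) // ltW.
- move=> x; rewrite ipZl mulrC ler_pdivrMr // (le_trans (ip_le _ _)) // -nm2.
  have := AM x; have := nm_ge0 x; have := nm_ge0 (A x); rewrite /m; nra.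
have Zl := sym_linear (pos_sym Zp).
exists (fun x => Num.sqrt m *: Z x); split.
- split=> x; first by move=> y; rewrite !ipE (pos_sym Zp).
  by rewrite ipZl mulr_ge0 ?sqrtr_ge0 ?(pos_ge0 Zp).
- move=> x; rewrite (linZ Zl) scalerA ZZ scalerA -expr2 sqr_sqrtr ?(ltW m0) //.
  by rewrite divff ?gt_eqF // scale1r.
- by move=> C Cl Cb CA x; rewrite (linZ Cl) ZC // => y; rewrite (linZ Cl) CA.
Qed.

(** The root Z of A commutes with B, so <A B x, x> = <B Z x, Z x>. *)
Lemma comm_pos A B : positive_op A -> positive_op B ->
  (forall x, A (B x) = B (A x)) -> positive_op (fun x => A (B x)).
Proof.
move=> Ap Bp AB; split=> x; first by move=> y; rewrite (pos_sym Ap) (pos_sym Bp) AB.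
have [Z [Zp ZZ ZC]] := positive_sqrt Ap.
rewrite -ZZ (pos_sym Zp) -ZC ?(pos_ge0 Bp) //.
- exact: sym_linear (pos_sym Bp).
- exact: sym_bounded (pos_sym Bp).
Qed.

(* The form [ip x (Q x)] is log-convex along the orbit of M, and cannot grow
   faster than c ^+ 2n; so its first ratio is at most c ^+ 2. *)
Theorem krein_lax (Q M : V -> V) c : positive_op Q -> 0 <= c ->
  (forall x, nm (M x) <= c * nm x) ->
  (forall x y, ip (M x) (Q y) = ip (Q x) (M y)) ->
  forall x, ip (M x) (Q x) <= c * ip x (Q x).
Proof.
move=> Qp c0 Mc MQ x; have [K K0 QK] := sym_bounded (pos_sym Qp).
pose y n := iter n M x; pose b n := ip (Q (y n)) (y n).
have b0 n : 0 <= b n by exact: pos_ge0.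
have y_le n : nm (y n) <= c ^+ n * nm x.
  elim: n => [|n IH]; first by rewrite expr0 mul1r.
  by rewrite exprS -mulrA /y iterS (le_trans (Mc _)) // ler_wpM2l.
(* Moving one M across the form gives b (n+1) = <Q y_n, y_(n+2)>, so log-convexity is Cauchy-Schwarz
   for Q. *)
have bS n : b n.+1 ^+ 2 <= b n * b n.+2.
  have -> : b n.+1 = ip (Q (y n)) (y n.+2) by rewrite /b /y !iterS -MQ ipC.
  exact: psd_cs.
have b_le n : b n <= K * nm x ^+ 2 * c ^+ n ^+ 2.
  have h1 := ip_le (Q (y n)) (y n).
  have h2 : nm (Q (y n)) * nm (y n) <= K * nm (y n) * nm (y n).
    by rewrite ler_wpM2r ?nm_ge0.
  have h3 : nm (y n) ^+ 2 <= (c ^+ n * nm x) ^+ 2.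
    by rewrite ler_pXn2r ?nnegrE ?mulr_ge0 ?exprn_ge0 ?nm_ge0.
  have : K * nm (y n) ^+ 2 <= K * (c ^+ n * nm x) ^+ 2 by rewrite ler_wpM2l.
  rewrite /b exprMn; move: h1 h2; rewrite expr2; lra.
have main : b 1%N <= c ^+ 2 * b 0%N.
  have [bz|bz] := eqVneq (b 0%N) 0.
    by have := bS 0%N; have := b0 1%N; rewrite bz mul0r mulr0; nra.
  have bp : 0 < b 0%N by rewrite lt_neqAle eq_sym bz b0.
  rewrite leNgt; apply/negP => hlt.
  have b1p : 0 < b 1%N by rewrite (le_lt_trans _ hlt) // mulr_ge0 ?sqr_ge0.
  pose q := b 1%N / b 0%N; have q0 : 0 < q by exact: divr_gt0.
  have qE : b 1%N = q * b 0%N by rewrite /q divfK.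
  have step n : 0 < b n /\ q * b n <= b n.+1.
    elim: n => [|n [p IH]]; first by rewrite qE.
    have p1 : 0 < b n.+1 by apply: lt_le_trans IH; rewrite mulr_gt0.
    split=> //; have := bS n; move: p1 p IH; move: (b n) (b n.+1) (b n.+2) => u v w; nra.
  have grow n : q ^+ n * b 0%N <= b n.
    elim: n => [|n IH]; first by rewrite expr0 mul1r.
    by rewrite exprS -mulrA; apply: (le_trans _ (step n).2); rewrite ler_wpM2l ?(ltW q0).
  have qc : c ^+ 2 < q by rewrite /q ltr_pdivlMr.
  have [cz|cz] := eqVneq c 0.
    by have := b_le 1%N; rewrite cz expr1 expr0n mulr0; lra.
  have cp : 0 < c by rewrite lt_neqAle eq_sym cz.
  have c2p : 0 < c ^+ 2 by exact: exprn_gt0.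
  pose r := q / c ^+ 2; have r1 : 1 < r by rewrite /r ltr_pdivlMr ?mul1r.
  have rE : q = r * c ^+ 2 by rewrite /r divfK ?gt_eqF.
  have bern k : 1 + k%:R * (r - 1) <= r ^+ k.
    elim: k => [|k IH]; first by rewrite mul0r addr0 expr0.
    have : 0 <= k%:R :> R by []; rewrite exprS -[k.+1%:R]natr1.
    move: IH; move: (k%:R) (r ^+ k) => l s IH l0.
    have : 0 <= (r - 1) * (s - (1 + l * (r - 1))) by rewrite mulr_ge0 ?subr_ge0 ?(ltW r1).
    have : 0 <= l * (r - 1) ^+ 2 by rewrite mulr_ge0 ?sqr_ge0.
    lra.
  have bnd n : (1 + n%:R * (r - 1)) * b 0%N <= K * nm x ^+ 2.
    have h := le_trans (grow n) (b_le n); rewrite rE exprMn (exprAC c n) in h.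
    have cn : 0 < c ^+ 2 ^+ n by rewrite !exprn_gt0.
    rewrite mulrAC (ler_pM2r cn) in h; apply: le_trans h.
    by rewrite ler_wpM2r // ltW.
  pose D := (r - 1) * b 0%N; have D0 : 0 < D by rewrite mulr_gt0 ?subr_gt0.
  have := archi_boundP (normr_ge0 (K * nm x ^+ 2 / D)); move: (Num.bound _) => n hn.
  have : K * nm x ^+ 2 < n%:R * D by rewrite -ltr_pdivrMr // (le_lt_trans (ler_norm _)).
  by have := bnd n; rewrite /D; lra.
(* Cauchy-Schwarz for Q again, between x and M x; with [main] the right-hand side is at most (c b
   0)^2. *)
have h : ip (M x) (Q x) ^+ 2 <= b 0%N * b 1%N.
  by rewrite ipC; exact: psd_cs.
rewrite (ipC x); have : 0 <= c * b 0%N by rewrite mulr_ge0.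
rewrite -/(b 0%N) => cb; rewrite (le_trans (ler_norm _)) //.
rewrite -(@ler_pXn2r _ 2) ?nnegrE // real_normK ?num_real //.
by apply: (le_trans h); rewrite exprMn; have := b0 0%N; nra.
Qed.

End BoundedOperators.

(** * Unbounded self-adjoint relations *)

Section Relations.
Variables (R : realType) (V : hilbert R).
Implicit Types (S T P A : set (V * V)) (x y z : V).

Definition radj S : set (V * V) :=
  [set p | forall x y, S (x, y) -> ip y p.1 = ip x p.2].

Definition rcomp S T : set (V * V) :=
  [set p | exists2 y, T (p.1, y) & S (y, p.2)].

Definition rdom S : set V := [set x | exists y, S (x, y)].

(** For a linear relation this is the density of the domain ([total_dense], [dense_total]). *)
Definition total_dom S := forall h, (forall x y, S (x, y) -> ip x h = 0) -> h = 0.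

Record psa S : Prop := Psa {
  psa_adj : radj S = S;
  psa_ge0 : forall x y, S (x, y) -> 0 <= ip y x;
  psa_total : total_dom S }.

(** T'' = T makes the graph both linear and closed, since every adjoint is ([adj_lin],
    [adj_near]). *)
Record closed_op T : Prop := ClosedOp {
  closed_adj : radj (radj T) = T;
  closed_single : forall y, T (0, y) -> y = 0;
  closed_total : total_dom T }.

Lemma adj_lin S : @linset R (V * V)%type (radj S).
Proof.
split=> [x y _|a [x y] [x' y'] h h' u v Suv]; first by rewrite !ip0r.
by rewrite /= !ipE (h _ _ Suv) (h' _ _ Suv).
Qed.

Lemma psa_lin S : psa S -> @linset R (V * V)%type S.
Proof. by move=> Sp; rewrite -(psa_adj Sp); exact: adj_lin. Qed.

Lemma closed_lin T : closed_op T -> @linset R (V * V)%type T.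
Proof. by move=> Tc; rewrite -(closed_adj Tc); exact: adj_lin. Qed.

Lemma psa_sym S x y x' y' : psa S -> S (x, y) -> S (x', y') -> ip y x' = ip x y'.
Proof. by move=> Sp h; rewrite -{1}(psa_adj Sp) => /(_ _ _ h). Qed.

Lemma psa_single S x y y' : psa S -> S (x, y) -> S (x, y') -> y = y'.
Proof.
move=> Sp h h'; apply/subr0_eq; apply: (psa_total Sp) => a b Sab.
by rewrite !ipE -(psa_sym Sp Sab h) -(psa_sym Sp Sab h') subrr.
Qed.

Lemma psa_closed S : psa S -> closed_op S.
Proof.
move=> Sp; split; rewrite ?(psa_adj Sp) //; last exact: psa_total.
by move=> y h; exact: psa_single h (psa_lin Sp).1.
Qed.

Lemma adj_near S p :
  (forall e, 0 < e -> exists2 q, radj S q & nm (q.1 - p.1) < e /\ nm (q.2 - p.2) < e) ->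
  radj S p.
Proof.
move=> h x y Sxy; apply/eqP; rewrite -subr_eq0 -normr_le0.
apply: (@ler_eps _ _ _ (nm x + nm y)) => e /h[q hq [h1 h2]].
have -> : ip y p.1 - ip x p.2 = ip x (q.2 - p.2) - ip y (q.1 - p.1).
  by rewrite !ipE (hq _ _ Sxy); ring.
rewrite add0r mulrDr; apply: (le_trans (ler_normB _ _)).
by rewrite lerD // (le_trans (cauchy_schwarz _ _)) // mulrC ler_wpM2r ?nm_ge0 // ltW.
Qed.

(** A substitute for weak compactness of balls: the bound on the images makes (u, v) |-> <v, x> at
    most C |u| on S, and its representing vector is an image of x. *)
Lemma rdom_adj S x C : @linset R (V * V)%type S -> 0 <= C ->
  (forall e, 0 < e -> exists x' y', [/\ radj S (x', y'), nm (x' - x) < e & nm y' <= C]) ->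
  rdom (radj S) x.
Proof.
move=> Sl C0 h.
have [//|a [u v] [u' v']|//|[u v] Suv|y [_ _ hy]] :=
    @riesz R (V * V)%type V S fst (fun p => ip p.2 x) C Sl.
- by rewrite /= ipDl ipZl.
- apply: (@ler_eps _ _ _ (nm v)) => e /h[x' [y' [hxy hx hC]]] /=.
  have -> : ip v x = ip u y' - ip v (x' - x) by rewrite ipDr ipNr (hxy _ _ Suv); ring.
  apply: (le_trans (ler_normB _ _)); apply: lerD.
    by rewrite (le_trans (cauchy_schwarz _ _)) // mulrC ler_wpM2r ?nm_ge0.
  by rewrite (le_trans (cauchy_schwarz _ _)) // mulrC ler_wpM2r ?nm_ge0 // ltW.
- by exists y => u v /hy.
Qed.

(** Positivity gives |x| <= |x + y| on S, so <x, m> is represented as <x + y, u>. Then <y, u> = <x,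
    m - u>, which puts (u, m - u) in S' = S. *)
Lemma psa_full S m : psa S -> exists u, S (u, m - u).
Proof.
move=> Sp.
have [a p q|a p q|||u [_ _ hu]] :=
    @riesz R (V * V)%type V S (fun p => p.1 + p.2) (fun p => ip p.1 m) (nm m) (psa_lin Sp).
- by rewrite scalerDr addrACA.
- by rewrite /= ipDl ipZl.
- exact: nm_ge0.
- move=> [x y] Sxy; rewrite (le_trans (cauchy_schwarz _ _)) // mulrC ler_wpM2l ?nm_ge0 //=.
  rewrite -(@ler_pXn2r _ 2) ?nnegrE ?nm_ge0 // !nm2 !ipE (ipC x y).
  by have := psa_ge0 Sp Sxy; have := ip_ge0 y; lra.
exists u; rewrite -(psa_adj Sp) => x y /hu /=; rewrite !ipE => ->; ring.
Qed.

(** For (u', v') in A', let u solve u + A u = u' + v'. Then u' - u is orthogonal to the range of 1 +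
    A, which is everything. *)
Lemma full_psa A :
  (forall x y x' y', A (x, y) -> A (x', y') -> ip y x' = ip x y') ->
  (forall x y, A (x, y) -> 0 <= ip y x) ->
  (forall m, exists u, A (u, m - u)) -> total_dom A -> psa A.
Proof.
move=> As A0 Af At; split=> //; rewrite eqEsubset.
split=> [[u' v'] huv|[u v] h x y /As]; last exact.
have [u hu] := Af (u' + v').
suff u'E : u' = u.
  by move: hu; rewrite -u'E addrC addKr.
apply/subr0_eq/ip_eq0; have [x hx] := Af (u' - u).
rewrite -{1}(subrK x (u' - u)).
have := huv _ _ hx; have := As _ _ _ _ hx hu; rewrite /= !ipE; lra.
Qed.

(** Q is (1 + S)^-1; the last clause recovers the graph of S from this bounded operator. *)
Lemma resolvent S : psa S -> exists Q, [/\ positive_op Q,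
  forall x, ip (Q x) x <= ip x x & forall x y, S (x, y) <-> x = Q (x + y)].
Proof.
move=> Sp; have /choice[Q hQ] : forall m, exists u, S (u, m - u).
  by move=> m; exact: psa_full.
have sq x : 0 <= ip (x - Q x) (Q x) by exact: psa_ge0 (hQ x).
have Q0 x : ip (Q x) (Q x) <= ip (Q x) x.
  by have := sq x; rewrite !ipE (ipC x); lra.
exists Q; split.
- split=> x; last by rewrite (le_trans _ (Q0 x)) ?ip_ge0.
  move=> y; have := psa_sym Sp (hQ x) (hQ y); rewrite !ipE; lra.
- move=> x; rewrite (le_trans (ip_le _ _)) // -nm2 expr2 ler_wpM2r ?nm_ge0 //.
  apply: nm_le_of_ip; first exact: nm_ge0.
  by rewrite (le_trans (Q0 x)) // mulrC; exact: ip_le.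
- move=> x y; split=> [Sxy|xE]; last by have := hQ (x + y); rewrite -xE addrC addKr.
  apply/subr0_eq/nm_eq0/eqP; set u := Q _.
  have hu : S (x - u, - (x - u)).
    have : S (-1 *: u + x, -1 *: (x + y - u) + y) := (psa_lin Sp).2 _ _ _ (hQ _) Sxy.
    by rewrite !scaleN1r (addrC _ x) !opprB opprD addrA subrK.
  have := psa_ge0 Sp hu; rewrite ipNl -nm2 oppr_ge0 => h.
  by rewrite -sqrf_eq0 eq_le h sqr_ge0.
Qed.

(* With X = (1 + S)^-1/2 and Y = (1 - (1 + S)^-1)^1/2, the square root of
   S = Y^2 X^-2 is Y X^-1. *)
Theorem psa_sqrt S : psa S -> exists P, [/\ psa P, rcomp P P = S
  & forall C : V -> V, linear C -> bounded_op C ->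
      (forall x y, S (x, y) -> S (C x, C y)) -> forall x y, P (x, y) -> P (C x, C y)].
Proof.
move=> Sp; have [Q [Qp Q1 SQ]] := resolvent Sp.
have [X [Xp XX XC]] := positive_sqrt Qp.
have Ql := sym_linear (pos_sym Qp).
have [|Y [Yp YY YC]] := @positive_sqrt _ _ (fun x => x - Q x).
  split=> x; first by move=> y; rewrite !ipE (pos_sym Qp).
  by rewrite !ipE subr_ge0.
have Xl := sym_linear (pos_sym Xp); have Yl := sym_linear (pos_sym Yp).
have XY x : X (Y x) = Y (X x).
  apply: YC => // [|z]; first exact: sym_bounded (pos_sym Xp).
  by rewrite (linB Xl) -!XX.
have XXYY x : X (X x) + Y (Y x) = x by rewrite XX YY addrC subrK.
have QS h : S (Q h, h - Q h) by apply/SQ; rewrite addrC subrK.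
(* Since X^2 + Y^2 = 1 and X, Y commute, the pairs (X h, Y h) are exactly the solutions of Y u = X
   v, with h = X u + Y v. *)
have joint u v : Y u = X v -> exists m, u = X m /\ v = Y m.
  move=> h; exists (X u + Y v); split; first by rewrite (linD Xl) XY -h XXYY.
  by rewrite (linD Yl) -XY h XXYY.
pose P : set (V * V) := [set p | exists h, p = (X h, Y h)].
have PE u v : P (u, v) <-> Y u = X v.
  split=> [[h [-> ->]]|/joint[m [-> ->]]]; first by rewrite XY.
  by exists m.
have CX (C : V -> V) : linear C -> bounded_op C ->
    (forall x y, S (x, y) -> S (C x, C y)) ->
    (forall x, C (X x) = X (C x)) /\ (forall x, C (Y x) = Y (C x)).
  move=> Cl Cb CS; have CQ x : C (Q x) = Q (C x).
    by have /SQ := CS _ _ (QS x); rewrite -(linD Cl) addrC subrK.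
  by split; [apply: XC|apply: YC => // x; rewrite (linB Cl) CQ].
exists P; split; first split.
- rewrite eqEsubset; split=> [[u v] h|[u v] /PE h x y /PE k] /=.
    apply/PE; apply: ip_inj => z; rewrite (pos_sym Yp) (pos_sym Xp) ipC.
    by rewrite (ipC v); apply: h; exists z.
  have [m [-> ->]] := joint _ _ k.
  by rewrite (pos_sym Yp) (pos_sym Xp) h.
- move=> x y [h [-> ->]]; rewrite (pos_sym Yp) -XY ipC.
  exact: (pos_ge0 (comm_pos Xp Yp XY)).
- move=> h hP; apply: (psa_total Sp) => x y /SQ ->; rewrite -XX; apply: hP.
  by exists (X (x + y)).
- rewrite eqEsubset; split=> [[u v] [z /PE /= h /PE /= k]|[u v] /SQ h] /=.
    have [m [hu hz]] := joint _ _ h; have [n [hz' hv]] := joint _ _ k.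
    have [w [hm hn]] := joint _ _ (etrans (esym hz) hz').
    by apply/SQ; rewrite hu hv hm hn XXYY XX.
  have -> : v = Y (Y (u + v)) by rewrite YY -{1}h addrC addKr.
  exists (X (Y (u + v))); apply/PE => /=; first by rewrite {1}h -XX !XY.
  by rewrite !XY.
- move=> C Cl Cb CS x y /PE h; apply/PE.
  by have [CX1 CY1] := CX C Cl Cb CS; rewrite -CX1 -CY1 h.
Qed.

(** Passing to the adjoint exchanges single-valuedness and density of the domain. *)
Lemma closed_op_adj T : closed_op T -> closed_op (radj T).
Proof.
move=> Tc; split; rewrite ?(closed_adj Tc) //.
  by move=> y h; apply: (closed_total Tc) => u v Tuv; rewrite -(h _ _ Tuv) ip0r.
move=> h hT; apply: (closed_single Tc); rewrite -(closed_adj Tc) => u v Tuv /=.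
by rewrite ip0r (hT _ _ Tuv).
Qed.

(** * Von Neumann's theorem on T'T, and the Loewner-Heinz inequality *)

Section VonNeumann.
Variable T : set (V * V).
Hypothesis Tc : closed_op T.

Let near_mem p :
  (forall e, 0 < e -> exists2 q, T q & nm (q.1 - p.1) < e /\ nm (q.2 - p.2) < e) -> T p.
Proof. by rewrite -(closed_adj Tc); exact: adj_near. Qed.

(** Solves u + T'T u = m. Riesz on the graph of T represents <x, m> as <x, u> + <T x, w> with (u, w)
    in T, so that T' w = m - u. *)
Lemma adjT_full m : exists u w, T (u, w) /\ radj T (w, m - u).
Proof.
have [a p q|a p q|||[u w] [h1 _ h2]] :=
    @riesz R (V * V)%type (hprod V V) T id (fun p => ip p.1 m) (nm m) (closed_lin Tc).
- by [].
- by rewrite /= ipDl ipZl.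
- exact: nm_ge0.
- move=> [x y] _; rewrite (le_trans (cauchy_schwarz _ _)) // mulrC ler_wpM2l ?nm_ge0 //.
  exact: (prod_le1 (x, y)).
exists u, w; split.
  apply: near_mem => e /h1[q Tq hq]; exists q => //; split.
    exact: (le_lt_trans (prod_le1 (q - (u, w))) hq).
  exact: (le_lt_trans (prod_le2 (q - (u, w))) hq).
by move=> x y /h2; rewrite prod_ipE /= !ipE; lra.
Qed.

Lemma comp_adjP u z : rcomp (radj T) T (u, z) ->
  exists2 w, T (u, w) & radj T (w, z) /\ nm w ^+ 2 = ip u z.
Proof. by case=> w /= h k; exists w => //; split; rewrite // nm2 (k _ _ h). Qed.

(** Only density is left by [full_psa]. If h is orthogonal to D(T'T) and u + T'T u = h, then 0 = <u,
    h> = |u|^2 + |T u|^2, so (0, h) lies in T' and h is orthogonal to D(T). *)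
Theorem von_neumann : psa (rcomp (radj T) T).
Proof.
apply: full_psa.
- move=> x y x' y' [w /= h k] [w' /= h' k'].
  by rewrite ipC -(k _ _ h') ipC (k' _ _ h).
- by move=> x y /comp_adjP[w _ [_ h]]; rewrite ipC -h sqr_ge0.
- by move=> m; have [u [w [h k]]] := adjT_full m; exists u, w.
- move=> h hA; have [u [w [Tu Tw]]] := adjT_full h.
  have h0 := hA _ _ (ex_intro2 _ _ w Tu Tw).
  have := Tw _ _ Tu; rewrite /= ipDr ipNr h0 => h1.
  have u0 : u = 0 by apply: ip_eq0; have := ip_ge0 w; have := ip_ge0 u; lra.
  have w0 : w = 0 by apply: ip_eq0; rewrite h1 u0 ip0l subr0.
  apply: (closed_total Tc) => x y /Tw /=.
  by rewrite u0 w0 subr0 ip0r.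
Qed.

(** D(T'T) is a core of T: if (d1, d2) in T is orthogonal, in the graph inner product, to T
    restricted to D(T'T), testing with the solution u of u + T'T u = d1 gives |d1|^2 = 0. *)
Lemma core x w e : T (x, w) -> 0 < e -> exists u w' z,
  [/\ T (u, w'), radj T (w', z), nm (u - x) < e & nm (w' - w) < e].
Proof.
move=> Txw e0; pose G : set (V * V) := [set p | T p /\ exists z, radj T (p.2, z)].
have Tl := closed_lin Tc.
have Gl : @linset R (hprod V V) G.
  split; first by split; [exact: Tl.1|exists 0; exact: (adj_lin T).1].
  move=> a p q [Tp [z hz]] [Tq [z' hz']]; split; first exact: Tl.2.
  by exists (a *: z + z'); exact: ((adj_lin T).2 a (p.2, z) (q.2, z')).
have [v hv orth] := @projection R (hprod V V) G (x, w) Gl.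
suff vE : (x, w) - v = 0.
  have [q [Tq [z hz]] hq] := hv e e0; rewrite -(subr0_eq vE) in hq.
  case: q => [u w'] in Tq hz hq; exists u, w', z; split=> //.
    exact: (le_lt_trans (prod_le1 ((u, w') - (x, w))) hq).
  exact: (le_lt_trans (prod_le2 ((u, w') - (x, w))) hq).
have Tv : T v.
  apply: near_mem => d /hv[q [Tq _] hq]; exists q => //; split.
    exact: (le_lt_trans (prod_le1 (q - v)) hq).
  exact: (le_lt_trans (prod_le2 (q - v)) hq).
have : T ((x, w) - v) by rewrite -scaleN1r addrC; exact: Tl.2.
move: ((x, w) - v) orth => [d1 d2] orth Td.
have d10 : d1 = 0.
  have [u [w' [Tu Tw]]] := adjT_full d1.
  have := orth (u, w') (conj Tu (ex_intro (fun z => radj T (w', z)) _ Tw)).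
  rewrite prod_ipE /=.
  rewrite (ipC w') (Tw _ _ Td) /= (ipC u) -ipDr addrC subrK.
  exact: ip_eq0.
by move: Td; rewrite d10 => /(closed_single Tc) ->.
Qed.

End VonNeumann.

(** On the common core |T1 u|^2 and |T2 u|^2 both equal <u, T1'T1 u>. So T2 stays bounded along core
    approximations of x, and [rdom_adj] applies to T2 = T2''. *)
Lemma rdom_le T1 T2 : closed_op T1 -> closed_op T2 ->
  rcomp (radj T1) T1 = rcomp (radj T2) T2 -> rdom T1 `<=` rdom T2.
Proof.
move=> c1 c2 E x [w Txw]; rewrite -(closed_adj c2).
apply: (@rdom_adj _ _ (nm w + 1)); first exact: adj_lin.
  by rewrite addr_ge0 ?nm_ge0.
move=> e e0; pose d := Num.min e 1.
have d0 : 0 < d by rewrite /d lt_min e0 ltr01.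
have [u [w' [z [h1 h2 h3 h4]]]] := core c1 Txw d0.
have [s h5 [_ h6]] : exists2 s, T2 (u, s) & radj T2 (s, z) /\ nm s ^+ 2 = ip u z.
  by apply: comp_adjP; rewrite -E; exists w'.
exists u, s; rewrite (closed_adj c2); split=> //.
  by rewrite (lt_le_trans h3) // ge_min lexx.
have -> : nm s = nm w'.
  apply/eqP; rewrite -(@eqrXn2 _ 2) ?nm_ge0 // h6.
  by rewrite nm2 (h2 _ _ h1).
by apply: nm_near; rewrite (lt_le_trans h4) // ge_min lexx orbT.
Qed.

(** S stands for |T|: being self-adjoint it satisfies S'S = T'T. *)
Lemma rdom_sqrt T S : closed_op T -> psa S -> rcomp S S = rcomp (radj T) T ->
  rdom S = rdom T.
Proof.
move=> Tc Sp E; have Sc := psa_closed Sp.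
have E' : rcomp (radj S) S = rcomp (radj T) T by rewrite (psa_adj Sp).
by rewrite eqEsubset; split; apply: rdom_le.
Qed.

(* The operator (1 + S2)^-1 S1 is bounded for the norm |(1 + S2) x| and
   symmetric for the form <(1 + S2) x, x>, hence bounded for that form. *)
Theorem heinz S1 S2 P1 P2 : psa S1 -> psa S2 -> psa P1 -> psa P2 ->
  rcomp P1 P1 = S1 -> rcomp P2 P2 = S2 -> rdom S2 `<=` rdom S1 ->
  rdom P2 `<=` rdom P1.
Proof.
move=> s1 s2 p1 p2 E1 E2 dS; have [Q [Qp _ SQ]] := resolvent s2.
have Ql := sym_linear (pos_sym Qp).
have SQm m : S2 (Q m, m - Q m) by apply/SQ; rewrite addrC subrK.
(* In the variable m = (1 + S2) x the operator becomes M = S1 Q, the norm |m| and the form <m, Q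
   m>. *)
have /choice[M hM] : forall m, exists y, S1 (Q m, y).
  by move=> m; apply: dS; exists (m - Q m).
have Ml : linear M.
  move=> a x y; apply: (psa_single s1 (hM _)); rewrite Ql.
  exact: (psa_lin s1).2 _ _ _ (hM x) (hM y).
have [|c c0 Mc] := closed_graph Ml.
  move=> x y near; apply: (psa_single s1) (hM x); rewrite -(psa_adj s1).
  have [K K0 QK] := sym_bounded (pos_sym Qp); have K1 : 0 < K + 1 by rewrite ltr_wpDl.
  apply: adj_near => e e0; pose d := Num.min e (e / (K + 1)).
  have d0 : 0 < d by rewrite /d lt_min e0 divr_gt0.
  have [z h1 h2] := near d d0; exists (Q z, M z); first by rewrite (psa_adj s1).
  split=> /=; last by rewrite (lt_le_trans h2) // ge_min lexx.
  rewrite -(linB Ql) (le_lt_trans (QK _)) //.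
  have : nm (z - x) < e / (K + 1) by rewrite (lt_le_trans h1) // ge_min lexx orbT.
  rewrite ltr_pdivlMr // => h3; apply: le_lt_trans h3.
  by rewrite mulrC ler_wpM2l ?nm_ge0 // lerDl.
have MQ x y : ip (M x) (Q y) = ip (Q x) (M y) by exact: psa_sym s1 (hM x) (hM y).
have KL := krein_lax Qp c0 Mc MQ.
move=> x [w P2xw]; rewrite -(psa_adj p1).
(* [krein_lax] gives |P1 u|^2 = <u, S1 u> <= c <u, (1 + S2) u> = c (|u|^2 + |P2 u|^2), and core
   approximations move |x| and |P2 x| by at most 1. *)
pose D := c * ((nm x + 1) ^+ 2 + (nm w + 1) ^+ 2).
have D0 : 0 <= D by rewrite mulr_ge0 // addr_ge0 ?sqr_ge0.
apply: (@rdom_adj _ _ (D + 1)); [exact: psa_lin|by rewrite addr_ge0|].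
move=> e e0; pose d := Num.min e 1.
have d0 : 0 < d by rewrite /d lt_min e0 ltr01.
have [u [w' [z []]]] := core (psa_closed p2) P2xw d0.
rewrite (psa_adj p2) => h1 h2 h3 h4.
have /SQ uE : S2 (u, z) by rewrite -E2; exists w'.
have [s h5 h6] : rcomp P1 P1 (u, M (u + z)) by rewrite E1 {1}uE; exact: hM.
exists u, s; rewrite (psa_adj p1); split=> //.
  by rewrite (lt_le_trans h3) // ge_min lexx.
have nu : nm u <= nm x + 1 by apply: nm_near; rewrite (lt_le_trans h3) // ge_min lexx orbT.
have nw : nm w' <= nm w + 1 by apply: nm_near; rewrite (lt_le_trans h4) // ge_min lexx orbT.
have : nm s ^+ 2 <= D.
  rewrite nm2 (psa_sym p1 h5 h6) /= ipC {2}uE (le_trans (KL _)) // -uE ler_wpM2l //.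
  rewrite ipDl (psa_sym p2 h2 h1 : ip z u = _) -!nm2.
  by rewrite lerD // ler_pXn2r ?nnegrE ?addr_ge0 ?nm_ge0.
have := nm_ge0 s; move: D0; move: (nm s) D => t D D0 t0; nra.
Qed.

(** The graph of Z^-1; its domain is the range of Z. *)
Definition inv_rel (Z : V -> V) : set (V * V) := [set p | p.1 = Z p.2].

Lemma inv_rel_psa Z : positive_op Z -> (forall x, Z x = 0 -> x = 0) ->
  psa (inv_rel Z).
Proof.
move=> Zp Zi; split.
- rewrite eqEsubset; split=> [[u v] h|[u v] uE x y xE] /=.
    apply: ip_inj => z; rewrite /= (pos_sym Zp) ipC (ipC v).
    exact: (h (Z z) z).
  by rewrite [u]uE [x]xE /= (pos_sym Zp).
- by move=> x y xE; rewrite [x]xE ipC; exact: pos_ge0.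
- move=> h hZ; apply: (inj_total (pos_sym Zp) Zi) => x.
  exact: (hZ (Z x) x).
Qed.

Lemma comp_inv_rel (A B : V -> V) :
  rcomp (inv_rel A) (inv_rel B) = inv_rel (fun x => B (A x)).
Proof.
rewrite eqEsubset; split=> [[u v] [y h k]|[u v] h]; last by exists (A v).
by rewrite /inv_rel /= [u]h [y]k.
Qed.

End Relations.

(** * Solvable forms over the reals *)

Lemma bounded_near (R : realType) (U W : hilbert R) (A : U -> W) (x : U) (y : W) :
  linear A -> bounded_op A ->
  (forall e, 0 < e -> exists2 z, nm (z - x) < e & nm (A z - y) < e) -> y = A x.
Proof.
move=> Al [M M0 AM] near; apply/subr0_eq/nm_eq0/eqP; rewrite eq_le nm_ge0 andbT.
apply: (@ler_eps _ _ _ (1 + M)) => e /near[z h1 h2].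
apply: (le_trans (nmD3 _ (A z) _)); rewrite nmB -(linB Al).
have := AM (z - x); have : M * nm (z - x) <= M * e by rewrite ler_wpM2l // ltW.
lra.
Qed.

(** Range inclusion gives a factorization k = i g, as in Douglas' lemma. The graph of g is closed
    because i is injective and continuous. *)
Lemma lift_bounded (R : realType) (X Y W : hilbert R) (i : X -> W) (k : Y -> W) :
  linear i -> bounded_op i -> (forall x, i x = 0 -> x = 0) ->
  linear k -> bounded_op k -> (forall y, exists x, i x = k y) ->
  exists g : Y -> X, (forall y, i (g y) = k y) /\ bounded_op g.
Proof.
move=> il [M M0 iM] ii kl kb /choice[g hg]; exists g; split=> //.
have inj x y : i x = i y -> x = y.
  by move=> h; apply/subr0_eq/ii; rewrite (linB il) h subrr.
apply: closed_graph => [a x y|x y near]; first by apply: inj; rewrite il !hg kl.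
apply: inj; rewrite hg; apply: bounded_near => // e e0.
have M1 : 0 < M + 1 by rewrite ltr_wpDl.
pose d := Num.min e (e / (M + 1)).
have d0 : 0 < d by rewrite /d lt_min e0 divr_gt0.
have [z h1 h2] := near d d0; exists z; first by rewrite (lt_le_trans h1) // ge_min lexx.
rewrite -hg -(linB il) (le_lt_trans (iM _)) //.
have : nm (g z - y) < e / (M + 1) by rewrite (lt_le_trans h2) // ge_min lexx orbT.
rewrite ltr_pdivlMr // => h3; apply: le_lt_trans h3.
by rewrite mulrC ler_wpM2l ?nm_ge0 // lerDl.
Qed.

(** * Bounded bilinear forms and solvability *)

Section BilinearForms.
Variable R : realType.

Record bounded_bilin (X Y : hilbert R) (f : X -> Y -> R) : Prop := BoundedBilin {
  bilinl : forall y a u v, f (a *: u + v) y = a * f u y + f v y;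
  bilinr : forall x a u v, f x (a *: u + v) = a * f x u + f x v;
  bilin_le : exists2 C, 0 <= C & forall x y, `|f x y| <= C * nm x * nm y }.

Lemma riesz_full (X : hilbert R) (l : X -> R) C :
  (forall a x y, l (a *: x + y) = a * l x + l y) -> 0 <= C ->
  (forall x, `|l x| <= C * nm x) -> exists2 w, nm w <= C & forall x, l x = ip x w.
Proof.
move=> ll C0 lC.
have [//|//|//|w [_ h1 h2]] := @riesz R X X setT id l C _ _ ll C0.
by exists w => // x; exact: h2.
Qed.

Lemma bilin_op (X Y : hilbert R) (f : X -> Y -> R) : bounded_bilin f ->
  exists A : X -> Y, [/\ linear A, bounded_op A & forall x y, f x y = ip (A x) y].
Proof.
move=> [fl fr [C C0 fC]].
have /choice[A hA] : forall x, exists w, nm w <= C * nm x /\ forall y, f x y = ip w y.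
  move=> x; have [||w h1 h2] := @riesz_full Y (f x) (C * nm x) (fr x).
  - by rewrite mulr_ge0 ?nm_ge0.
  - exact: fC.
  by exists w; split=> // y; rewrite ipC.
exists A; split=> [a x y||x y]; last exact: (hA x).2.
- by apply: ip_inj => z; rewrite ipDl ipZl -!(hA _).2 fl.
- by exists C => // x; exact: (hA x).1.
Qed.

Lemma op_bilin (X Y : hilbert R) (A : X -> Y) : linear A -> bounded_op A ->
  bounded_bilin (fun x y => ip (A x) y).
Proof.
move=> Al [C C0 AC]; split=> [y a u v|x a u v|]; first by rewrite Al ipDl ipZl.
- by rewrite ipDr ipZr.
- by exists C => // x y; rewrite (le_trans (cauchy_schwarz _ _)) // ler_wpM2r ?nm_ge0.
Qed.

Lemma bilin_swap (X Y : hilbert R) (f : X -> Y -> R) : bounded_bilin f ->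
  bounded_bilin (fun y x => f x y).
Proof.
move=> [fl fr [C C0 fC]]; split=> //; exists C => // x y.
by rewrite mulrAC.
Qed.

Lemma bilin0l (X Y : hilbert R) (f : X -> Y -> R) y : bounded_bilin f -> f 0 y = 0.
Proof. by move=> fb; have [A [Al _ ->]] := bilin_op fb; rewrite (lin0 Al) ip0l. Qed.

Record solvable_form (E : hilbert R) (a : E -> E -> R) : Prop := SolvableForm {
  solvable_bilin : bounded_bilin a;
  solvable_inj : forall x, (forall y, a x y = 0) -> x = 0;
  solvable_surj : forall l : E -> R,
    (forall t x y, l (t *: x + y) = t * l x + l y) ->
    (exists C, forall x, `|l x| <= C * nm x) ->
    exists x, forall y, l y = a x y }.

Section Solvable.
Variables (E : hilbert R) (a : E -> E -> R).
Hypothesis a_solvable : solvable_form a.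
Let ab := solvable_bilin a_solvable.

(** k is A^-1 G, where A and G represent a and g; [lift_bounded] makes it bounded. *)
Lemma solution_op (F : hilbert R) (g : F -> E -> R) : bounded_bilin g ->
  exists k : F -> E, [/\ linear k, bounded_op k & forall f y, a (k f) y = g f y].
Proof.
move=> gb; have [A [Al Ab hA]] := bilin_op ab; have [G [Gl Gb hG]] := bilin_op gb.
have ker x : A x = 0 -> x = 0.
  by move=> Ax; apply: (solvable_inj a_solvable) => y; rewrite hA Ax ip0l.
have [|k [hk kb]] := lift_bounded Al Ab ker Gl Gb.
  move=> f; have [||x hx] := solvable_surj a_solvable (l := g f).
  - exact: bilinr gb f.
  - by have [C C0 gC] := bilin_le gb; exists (C * nm f).
  by exists x; apply: ip_inj => y; rewrite -hA -hG.
exists k; split=> // [c x y|f y]; last by rewrite hA hG hk.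
by apply/subr0_eq/ker; rewrite (linB Al) Al !hk Gl subrr.
Qed.

Lemma solvable_uniq x x' : (forall y, a x y = a x' y) -> x = x'.
Proof.
move=> h; apply/subr0_eq/(solvable_inj a_solvable) => y.
by rewrite -scaleN1r addrC (bilinl ab) h mulN1r addNr.
Qed.

(** The adjoint of a bijective bounded operator A is bijective. Injectivity comes from solving a (z,
    y) = <x, y>; a preimage of w is w' = (A^-1)' w, which exists since A^-1 is bounded. *)
Lemma solvable_swap : solvable_form (fun x y => a y x).
Proof.
split; first exact: bilin_swap.
- move=> x hx; have [||z hz] := solvable_surj a_solvable (l := fun y => ip x y).
  + by move=> t u v; rewrite ipDr ipZr.
  + by exists (nm x) => y; exact: cauchy_schwarz.
  by apply: ip_eq0; rewrite hz hx.
move=> l ll [C lC].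
have [||w _ hw] := @riesz_full E l `|C| ll.
- exact: normr_ge0.
- by move=> x; rewrite (le_trans (lC x)) // ler_wpM2r ?nm_ge0 ?ler_norm.
have idb : bounded_op (@id E) by exists 1 => // x; rewrite mul1r.
have [k [kl [M M0 kM] hk]] := solution_op (@op_bilin E E id (fun _ _ _ => erefl) idb).
have [|||w' _ hw'] := @riesz_full E (fun z => ip (k z) w) (M * nm w).
- by move=> t x y; rewrite kl ipDl ipZl.
- by rewrite mulr_ge0 ?nm_ge0.
- by move=> x; rewrite (le_trans (cauchy_schwarz _ _)) // mulrAC ler_wpM2r ?nm_ge0.
exists w' => y; have [A [Al Ab hA]] := bilin_op ab.
rewrite hA -hw' hw; congr ip; apply: solvable_uniq => z.
by rewrite hk hA.
Qed.

End Solvable.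

(** * The operator associated with a form on a densely embedded space *)

Section AssociatedRelation.
Variables (E H : hilbert R) (iota : E -> H).
Hypotheses (iota_lin : linear iota) (iota_bdd : bounded_op iota).
Hypothesis iota_inj : forall x, iota x = 0 -> x = 0.
Hypothesis iota_dense : forall h, (forall x, ip (iota x) h = 0) -> h = 0.

Definition assoc (w : E -> E -> R) : set (H * H) :=
  [set p | exists2 x, iota x = p.1 & forall y, w x y = ip p.2 (iota y)].

Section OneForm.
Variables (w : E -> E -> R) (u : H -> H -> R).
Hypothesis ub : bounded_bilin u.
Let a x y := w x y + u (iota x) (iota y).
Hypothesis a_solvable : solvable_form a.

Lemma iota_eq x y : iota x = iota y -> x = y.
Proof. by move=> h; apply/subr0_eq/iota_inj; rewrite (linB iota_lin) h subrr. Qed.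

Lemma resolvent_op : exists k : H -> E,
  [/\ linear k, bounded_op k & forall h y, a (k h) y = ip h (iota y)].
Proof.
apply: (@solution_op E a a_solvable H (fun h y => ip h (iota y))).
have [fl fr [C C0 fC]] := bilin_swap (op_bilin iota_lin iota_bdd).
split=> [y t x x'|x t y y'|]; [by rewrite ipDl ipZl|by rewrite iota_lin ipDr ipZr|].
by exists C => // x y; rewrite ipC.
Qed.

End OneForm.

Section TwoForms.
Variables (w : E -> E -> R) (u : H -> H -> R).
Hypothesis ub : bounded_bilin u.
Let a x y := w x y + u (iota x) (iota y).
Hypothesis a_solvable : solvable_form a.

Let swap_solvable : solvable_form (fun x y => w y x + u (iota y) (iota x)) :=
  solvable_swap a_solvable.

(** T x = y means (T + B) x = y + B x, that is x = K (y + B x) with K = iota k the inverse of T + B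
    and B the operator of u. The swapped form has K' and B' instead. *)
Lemma assoc_param : exists k ks : H -> E, exists B Bs : H -> H,
 [/\ [/\ linear k, bounded_op k, linear ks & bounded_op ks],
     [/\ forall h y, a (k h) y = ip h (iota y)
       & forall h y, a y (ks h) = ip h (iota y)],
     [/\ forall h g, ip (B h) g = ip h (Bs g),
         forall x y, assoc w (x, y) <-> x = iota (k (y + B x))
       & forall x y, assoc (fun x y => w y x) (x, y) <-> x = iota (ks (y + Bs x))]
   & [/\ forall h g, ip (iota (k h)) g = ip h (iota (ks g)),
         forall h, iota (k h) = 0 -> h = 0
       & forall h, iota (ks h) = 0 -> h = 0] ].
Proof.
have [k [kl kb hk]] := resolvent_op a_solvable.
have [ks [ksl ksb hks]] := @resolvent_op (fun x y => w y x) (fun x y => u y x) swap_solvable.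
have [B [_ _ hB]] := bilin_op ub; have [Bs [_ _ hBs]] := bilin_op (bilin_swap ub).
have BBs h g : ip (B h) g = ip h (Bs g) by rewrite -hB ipC -hBs.
exists k, ks, B, Bs; split=> //.
- split=> // x y.
  + split=> [[e /= <- he]|xE].
      by congr iota; apply: (solvable_uniq a_solvable) => z; rewrite [RHS]hk /a he hB ipDl.
    exists (k (y + B x)) => // z; have := hk (y + B x) z; rewrite -xE hB ipDl /=; lra.
  + split=> [[e /= <- he]|xE].
      by congr iota; apply: (solvable_uniq swap_solvable) => z; rewrite [RHS]hks he hBs ipDl.
    exists (ks (y + Bs x)) => // z; have := hks (y + Bs x) z; rewrite -xE hBs ipDl /=; lra.
- split=> [h g|h /iota_inj h0|h /iota_inj h0].
  + by rewrite -hk ipC -hks.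
  + apply: iota_dense => x; rewrite ipC -hk h0.
    exact: bilin0l (solvable_bilin a_solvable).
  + apply: iota_dense => x; rewrite ipC -hks h0.
    exact: bilin0l (solvable_bilin swap_solvable).
Qed.

(** Each z yields the pair (K z, z - B K z) of T. Testing (x, y) in T' on these pairs gives <z, x> =
    <K z, y + B' x>, hence x = K' (y + B' x). *)
Lemma assoc_adj : radj (assoc w) = assoc (fun x y => w y x).
Proof.
have [k [ks [B [Bs [_ _ [BBs TP TsP] [kks _ _]]]]]] := assoc_param.
have Tin h : assoc w (iota (k h), h - B (iota (k h))).
  by apply/TP; rewrite subrK.
rewrite eqEsubset; split=> [[x y] hT|[x y] /TsP hxy c d /TP hcd] /=.
- apply/TsP; apply: ip_inj => z; rewrite (ipC (iota _)) -kks ipDr -BBs.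
  by have := hT _ _ (Tin z); rewrite /= !ipE (ipC x); lra.
- have h1 := kks (d + B c) (y + Bs x); rewrite -hcd -hxy in h1.
  by move: h1; rewrite ipDr ipDl BBs; lra.
Qed.

Lemma assoc_total : total_dom (assoc w).
Proof.
have [k [ks [B [Bs [_ _ [_ TP _] [kks _ ks0]]]]]] := assoc_param.
move=> h hT; apply: ks0; apply: ip_eq0; rewrite -kks.
set z := iota (ks h); apply: (hT _ (z - B (iota (k z)))).
by apply/TP; rewrite subrK.
Qed.

End TwoForms.

Lemma assoc_closed (w : E -> E -> R) (u : H -> H -> R) : bounded_bilin u ->
  solvable_form (fun x y => w x y + u (iota x) (iota y)) -> closed_op (assoc w).
Proof.
move=> ub ws; have adjE := assoc_adj ub ws.
have adjE' := @assoc_adj (fun x y => w y x) _ (bilin_swap ub) (solvable_swap ws).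
split; last exact: assoc_total ub ws.
- by rewrite adjE adjE'.
- move=> y; rewrite -[assoc w]adjE' => h.
  apply: (@assoc_total (fun x y => w y x) _ (bilin_swap ub) (solvable_swap ws)) => c d cd.
  by rewrite -(h _ _ cd) ip0r.
Qed.

(** * Domains of the square roots and their comparison with the form domain *)

Section SquareRootDomains.
Variables (w : E -> E -> R) (u : H -> H -> R).
Hypothesis ub : bounded_bilin u.
Let a x y := w x y + u (iota x) (iota y).
Hypothesis ws : solvable_form a.
Let T := assoc w.

Lemma sqrt_domains :
  exists (k : H -> E) (Z Zs V : H -> H),
  [/\ linear k /\ bounded_op k,
      forall h y, a (k h) y = ip h (iota y),
      [/\ positive_op Z, positive_op Zs & forall x, Z x = 0 -> x = 0],
      [/\ forall f, iota (k f) = Z (Z (V f)) & forall f, nm (Zs f) = nm (Z (V f))]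
    & (forall S P, psa S -> psa P -> rcomp S S = rcomp (radj T) T -> rcomp P P = S ->
         forall x, rdom P x <-> exists y, x = Z y) /\
      (forall S P, psa S -> psa P -> rcomp S S = rcomp T (radj T) -> rcomp P P = S ->
         forall x, rdom P x <-> exists y, x = Zs y)].
Proof.
have [k [ks [B [Bs [[kl kb ksl ksb] [hk hks] [BBs TP TsP] [kks k0 ks0]]]]]] :=
  assoc_param ub ws.
pose K h := iota (k h); pose Ks h := iota (ks h).
have Kadj h g : ip (K h) g = ip h (Ks g) by exact: kks.
have Kadj' h g : ip (Ks h) g = ip h (K g) by rewrite ipC -Kadj ipC.
have adj_inv (A A' : H -> H) : (forall h g, ip (A h) g = ip h (A' g)) ->
    radj (inv_rel A) = inv_rel A'.
  move=> AA; rewrite eqEsubset; split=> [[x y] h|[x y] xE c d cE].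
    by apply: ip_inj => z; rewrite ipC (ipC (A' _)) -AA; exact: h (A z) z erefl.
  by rewrite [c]cE [x]xE AA.
have inv_closed (A A' : H -> H) : (forall h g, ip (A h) g = ip h (A' g)) ->
    (forall h, A h = 0 -> h = 0) -> (forall h, A' h = 0 -> h = 0) -> closed_op (inv_rel A).
  move=> AA A0 A'0; have AA' h g : ip (A' h) g = ip h (A g) by rewrite ipC -AA ipC.
  split; first by rewrite (adj_inv _ _ AA) (adj_inv _ _ AA').
  - by move=> y h; apply: A0; exact: (esym h).
  - move=> h hA; apply: A'0; apply: ip_eq0; rewrite -AA.
    exact: hA (A (A' h)) (A' h) erefl.
have inj_sq (A Z : H -> H) : (forall x, Z (Z x) = A x) -> linear Z ->
    (forall x, A x = 0 -> x = 0) -> forall x, Z x = 0 -> x = 0.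
  by move=> ZZ Zl A0 x Zx; apply: A0; rewrite -ZZ Zx (lin0 Zl).
have Mp : positive_op (fun x => K (Ks x)).
  split=> x; first by move=> y; rewrite Kadj Kadj'.
  by rewrite Kadj ip_ge0.
have [W [Wp WW _]] := positive_sqrt Mp.
have Wl := sym_linear (pos_sym Wp).
have W0 : forall x, W x = 0 -> x = 0.
  by apply: inj_sq WW Wl _ => x /k0/ks0.
have domE (A A' Q : H -> H) : (forall h g, ip (A h) g = ip h (A' g)) ->
    (forall h, A h = 0 -> h = 0) -> (forall h, A' h = 0 -> h = 0) ->
    positive_op Q -> (forall x, Q x = 0 -> x = 0) ->
    (forall x, Q (Q x) = A (A' x)) -> rdom (inv_rel Q) = rdom (inv_rel A).
  move=> AA A0 A'0 Qp Q0 QQ; apply: rdom_sqrt; first exact: inv_closed A0 A'0.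
  - exact: inv_rel_psa.
  - rewrite (adj_inv _ _ AA) !comp_inv_rel; congr inv_rel.
    by apply/funext => x; rewrite QQ.
have domW : rdom (inv_rel W) = rdom (inv_rel K) by exact: domE K Ks W Kadj k0 ks0 Wp W0 WW.
have /choice[V hV] : forall f, exists v, K f = W v.
  move=> f; have : rdom (inv_rel K) (K f) by exists f.
  by rewrite -domW.
pose Ws f := Ks (V f).
have Wsf f g : ip (Ws f) g = ip (V f) (W (V g)) by rewrite Kadj' hV.
have Wsp : positive_op Ws.
  split=> x; last by rewrite Wsf ipC; exact: pos_ge0.
  by move=> y; rewrite Wsf ipC (ipC x) Wsf (pos_sym Wp) ipC.
have VKs x : V (Ks x) = W x.
  by apply/subr0_eq/W0; rewrite (linB Wl) -hV WW subrr.
have WsWs x : Ws (Ws x) = Ks (K x) by rewrite /Ws VKs -hV.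
have Ws0 : forall x, Ws x = 0 -> x = 0.
  by apply: inj_sq WsWs (sym_linear (pos_sym Wsp)) _ => x /ks0/k0.
have domWs : rdom (inv_rel Ws) = rdom (inv_rel Ks).
  exact: domE Ks K Ws Kadj' ks0 k0 Wsp Ws0 WsWs.
have [Z [Zp ZZ _]] := positive_sqrt Wp; have [Zs [Zsp ZZs _]] := positive_sqrt Wsp.
have Z0 := inj_sq _ _ ZZ (sym_linear (pos_sym Zp)) W0.
have Zs0 := inj_sq _ _ ZZs (sym_linear (pos_sym Zsp)) Ws0.
(* [heinz] in both directions: S and Q^-1 have the same domain, hence so do their square roots P and
   Y^-1. *)
have domS T1 (A Q Y : H -> H) S P : closed_op T1 -> rdom T1 = rdom (inv_rel A) ->
    positive_op Q -> (forall x, Q x = 0 -> x = 0) -> rdom (inv_rel Q) = rdom (inv_rel A) ->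
    positive_op Y -> (forall x, Y x = 0 -> x = 0) -> (forall x, Y (Y x) = Q x) ->
    psa S -> psa P -> rcomp S S = rcomp (radj T1) T1 -> rcomp P P = S ->
    forall x, rdom P x <-> exists y, x = Y y.
  move=> T1c T1A Qp Q0 QA Yp Y0 YY Sp Pp SS PP x.
  have dS : rdom S = rdom (inv_rel Q) by rewrite (rdom_sqrt T1c Sp SS) T1A QA.
  have Qpsa := inv_rel_psa Qp Q0; have Ypsa := inv_rel_psa Yp Y0.
  have YQ : rcomp (inv_rel Y) (inv_rel Y) = inv_rel Q.
    by rewrite comp_inv_rel; congr inv_rel; apply/funext => z; rewrite YY.
  suff -> : rdom P = rdom (inv_rel Y) by [].
  rewrite eqEsubset; split.
    by apply: (heinz Qpsa Sp Ypsa Pp YQ PP); rewrite dS.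
  by apply: (heinz Sp Qpsa Pp Ypsa PP YQ); rewrite dS.
have Tc : closed_op T by exact: assoc_closed ub ws.
(* T and K^-1 = T + B differ by an everywhere defined operator. *)
have domT : rdom T = rdom (inv_rel K).
  rewrite eqEsubset; split=> [x [y /TP xE]|x [y xE]]; first by exists (y + B x).
  by exists (y - B x); apply/TP; rewrite subrK.
have domTs : rdom (radj T) = rdom (inv_rel Ks).
  rewrite (assoc_adj ub ws).
  rewrite eqEsubset; split=> [x [y /TsP xE]|x [y xE]]; first by exists (y + Bs x).
  by exists (y - Bs x); apply/TsP; rewrite subrK.
exists k, Z, Zs, V; split=> //.
- split=> f; first by rewrite ZZ -hV.
  (* |Zs f|^2 = <Ws f, f> = <V f, W V f> = |Z V f|^2. *)
  apply/eqP; rewrite -(@eqrXn2 _ 2) ?nm_ge0 // !nm2.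
  by rewrite !(pos_sym Zp, pos_sym Zsp) ZZ ZZs ipC Wsf.
- split=> S P Sp Pp SS PP.
    exact: domS Tc domT Wp W0 domW Zp Z0 ZZ Sp Pp SS PP.
  apply: (domS _ _ _ _ _ _ (closed_op_adj Tc) domTs Wsp Ws0 domWs Zsp Zs0 ZZs Sp Pp _ PP).
  by rewrite (closed_adj Tc).
Qed.

Theorem sqrt_domain_transfer S P Ss Ps :
  psa S -> psa P -> rcomp S S = rcomp (radj T) T -> rcomp P P = S ->
  psa Ss -> psa Ps -> rcomp Ss Ss = rcomp T (radj T) -> rcomp Ps Ps = Ss ->
  (rdom P `<=` range iota -> range iota `<=` rdom Ps) /\
  (range iota `<=` rdom P -> rdom Ps `<=` range iota).
Proof.
move=> Sp Pp SS PP Ssp Psp SsSs PsPs.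
have [k [Z [Zs [V [[kl kb] hk [Zp Zsp Z0] [kZ nZ] [hP hPs]]]]]] := sqrt_domains.
have {hP}PE := hP S P Sp Pp SS PP; have {hPs}PsE := hPs Ss Ps Ssp Psp SsSs PsPs.
have Zl := sym_linear (pos_sym Zp); have Zsl := sym_linear (pos_sym Zsp).
have Zb := sym_bounded (pos_sym Zp); have Zsb := sym_bounded (pos_sym Zsp).
split=> [PD _ [y _ <-]|DP _ /PsE[v ->]].
(* Z = iota g with g bounded into E, so |k f| <= C |Z V f| = C |Zs f|. Hence <f, y> = a (k f, y) is
   bounded by |Zs f| and equals <Zs f, v> for some v. *)
- have [|g [hg [C C0 gC]]] := lift_bounded iota_lin iota_bdd iota_inj Zl Zb.
    by move=> h; have [|x _ hx] := PD (Z h); [apply/PE; exists h|exists x].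
  have [M M0 aM] := bilin_le (solvable_bilin ws).
  have kg f : k f = g (Z (V f)) by apply: iota_eq; rewrite hg kZ.
  have [|||||v [_ _ hv]] := @riesz R H H setT Zs (fun f => ip f (iota y)) (M * C * nm y).
  + by split.
  + exact: Zsl.
  + by move=> t f f'; rewrite ipDl ipZl.
  + by rewrite !mulr_ge0 ?nm_ge0.
  + move=> f _; rewrite -hk (le_trans (aM _ _)) // kg nZ.
    have := gC (Z (V f)) => h.
    have : M * nm (g (Z (V f))) * nm y <= M * (C * nm (Z (V f))) * nm y.
      by rewrite ler_wpM2r ?nm_ge0 // ler_wpM2l.
    lra.
  apply/PsE; exists v; apply: ip_inj => z.
  by rewrite ipC (hv z I) (pos_sym Zsp) ipC.
(* Now iota = Z g, so |Zs f| = |g (k f)| <= C |k f|, and <Zs f, v> becomes a functional of k f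
   bounded in E. *)
- have [|g [hg [C C0 gC]]] := lift_bounded Zl Zb Z0 iota_lin iota_bdd.
    by move=> x; have /PE[h hx] := DP (iota x) (imageP iota I); exists h.
  have kg f : g (k f) = Z (V f).
    by apply/subr0_eq/Z0; rewrite (linB Zl) hg kZ subrr.
  have [|||||z [_ _ hz]] := @riesz R H E setT k (fun f => ip (Zs f) v) (nm v * C).
  + by split.
  + exact: kl.
  + by move=> t f f'; rewrite Zsl ipDl ipZl.
  + by rewrite mulr_ge0 ?nm_ge0.
  + move=> f _; rewrite (le_trans (cauchy_schwarz _ _)) // nZ -kg mulrC -mulrA.
    by rewrite ler_wpM2l ?nm_ge0.
  (* Swapped solvability writes <x, z> as a (x, y); at x = k f this is <f, iota y>, so Zs v = iota
     y. *)
  have [||y hy] := solvable_surj (solvable_swap ws) (l := fun x => ip x z).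
  + by move=> t x x'; rewrite ipDl ipZl.
  + by exists (nm z) => x; rewrite mulrC cauchy_schwarz.
  exists y => //; apply: ip_inj => f.
  rewrite ipC -hk ipC -(pos_sym Zsp) hz // hy //.
Qed.

End SquareRootDomains.
End AssociatedRelation.
End BilinearForms.

(** * From complex to real Hilbert spaces *)

Section ComplexNumbers.
Variable R : realType.
Implicit Types z t : R[i].

Definition iu : R[i] := (0 +i* 1)%C.

Lemma reD z t : complex.Re (z + t) = complex.Re z + complex.Re t.
Proof. by case: z t => ? ? [? ?]. Qed.

Lemma re_rM (r : R) z : complex.Re (r%:C%C * z) = r * complex.Re z.
Proof. by case: z => a b /=; rewrite mul0r subr0. Qed.

Lemma re_iM z : complex.Re (iu * z) = - complex.Im z.
Proof. by case: z => a b /=; rewrite mul0r mul1r sub0r. Qed.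

Lemma re_conj z : complex.Re (Num.conj z) = complex.Re z.
Proof. by case: z. Qed.

Lemma conj_iu : Num.conj iu = - iu.
Proof. by apply/eqP; rewrite eq_complex /= oppr0 !eqxx. Qed.

Lemma conj_real (r : R) : Num.conj r%:C%C = r%:C%C.
Proof. by apply/eqP; rewrite eq_complex /= oppr0 !eqxx. Qed.

Lemma re_inj z t : complex.Re z = complex.Re t ->
  complex.Re (iu * z) = complex.Re (iu * t) -> z = t.
Proof.
rewrite !re_iM => h /oppr_inj k; apply/eqP.
by rewrite eq_complex h k !eqxx.
Qed.

Lemma ge0_real z : 0 <= z -> (complex.Re z)%:C%C = z.
Proof. by move=> h; rewrite RRe_real ?ger0_real. Qed.

Lemma re_ge0 z : 0 <= z -> 0 <= complex.Re z.
Proof. by rewrite lecE => /andP[_]. Qed.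

Lemma norm_re z : `|complex.Re z|%:C%C <= `|z|.
Proof. exact: normc_ge_Re. Qed.

Lemma norm_le_parts z : `|z| <= (`|complex.Re z| + `|complex.Im z|)%:C%C.
Proof.
rewrite {1}(complexE z) (le_trans (ler_normD _ _)) // normrM rmorphD /=.
have n (r : R) : `|r%:C%C| = `|r|%:C%C :> R[i].
  by rewrite normc_def /= expr0n addr0 sqrtr_sqr.
have -> : `|('i)%C| = 1 :> R[i] by rewrite normc_def /= expr0n add0r expr1n sqrtr1.
by rewrite mul1r !n.
Qed.

End ComplexNumbers.

(** * Complex spaces as real Hilbert spaces *)

Section Realification.
Variables (R : realType) (V : lmodType R[i]).

(** An alias, so that scaling by R does not clash with the R[i]-module structure of V. *)
Definition realified : Type := V.

HB.instance Definition _ := GRing.Zmodule.on realified.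

Definition real_scale (r : R) (x : realified) : realified := r%:C%C *: (x : V).

Fact real_scaleA a b x : real_scale a (real_scale b x) = real_scale (a * b) x.
Proof. by rewrite /real_scale scalerA -rmorphM. Qed.

Fact real_scale1 : left_id 1 real_scale.
Proof. by move=> x; rewrite /real_scale scale1r. Qed.

Fact real_scaleDr : right_distributive real_scale +%R.
Proof. by move=> a x y; rewrite /real_scale scalerDr. Qed.

Fact real_scaleDl x : {morph real_scale^~ x : a b / a + b}.
Proof. by move=> a b; rewrite /real_scale rmorphD scalerDl. Qed.

HB.instance Definition _ := GRing.Zmodule_isLmodule.Build R realified
  real_scaleA real_scale1 real_scaleDr real_scaleDl.

Lemma real_scaleE (r : R) (x : realified) : r *: x = r%:C%C *: (x : V) :> V.
Proof. by []. Qed.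

Variables (c : {dot V for Num.conj}) (N : V -> R[i]).
Hypotheses (N_norm : is_norm N) (N_sq : forall x, N x ^+ 2 = c x x).
Hypothesis N_compl : norm_complete N.

Lemma dot_conj x y : Num.conj (c x y) = c y x.
Proof. by rewrite (hermC c y x) expr0 mul1r. Qed.

Lemma is_norm_ge0 x : 0 <= N x.
Proof.
have [h1 h2 _] := N_norm.
have N0 : N 0 = 0 by have := h2 0 0; rewrite scale0r normr0 mul0r.
have NN : N (- x) = N x by rewrite -scaleN1r h2 normrN normr1 mul1r.
by have := h1 x (- x); rewrite subrr N0 NN -mulr2n pmulrn_lge0.
Qed.

Lemma dot_ge0 x : 0 <= c x x.
Proof. by rewrite -N_sq exprn_ge0 ?is_norm_ge0. Qed.

Lemma norm_dot x : (Num.sqrt (complex.Re (c x x)))%:C%C = N x.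
Proof.
have n0 := is_norm_ge0 x; rewrite -N_sq -[in LHS](ge0_real n0) -rmorphXn /=.
by rewrite sqrtr_sqr ger0_norm ?re_ge0 // ge0_real.
Qed.

Definition real_hilbert : hilbert R.
Proof.
apply: (@Hilbert R realified (fun x y => complex.Re (c x y))).
- by move=> x y; rewrite -dot_conj re_conj.
- by move=> x y z; rewrite linearDl reD.
- by move=> a x y; rewrite real_scaleE linearZl_LR /= re_rM.
- by move=> x; exact: re_ge0 (dot_ge0 x).
- move=> x h; have [_ _ h3] := N_norm; apply: h3.
  by rewrite -norm_dot h sqrtr0.
- move=> u hu; have [e e0|l hl] := N_compl (u := u).
    have eE := ge0_real (ltW e0).
    have [|n0 hn] := hu (complex.Re e); first by rewrite -ltcR eE.
    by exists n0 => m n hm hn'; rewrite -norm_dot -eE ltcR hn.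
  exists l => e e0; have [|n0 hn] := hl (e%:C)%C; first by rewrite ltcR.
  by exists n0 => n /hn; rewrite -norm_dot ltcR.
Defined.

Lemma real_nm (x : real_hilbert) : (nm x)%:C%C = N x.
Proof. exact: norm_dot. Qed.

Lemma nm_iu (x : V) : nm (iu R *: x : real_hilbert) = nm (x : real_hilbert).
Proof.
have [_ h2 _] := N_norm.
apply: (@complexI R); rewrite !real_nm h2 normc_def /= expr0n add0r expr1n sqrtr1.
by rewrite mul1r.
Qed.

End Realification.

(** * Complex adjoints, square roots and absolute values in real terms *)

Section ComplexRelations.
Variables (R : realType) (H : completeNormedModType R[i]).
Variable inner : {dot H for Num.conj}.
Hypothesis inner_norm : forall x : H, `|x| ^+ 2 = inner x x.

Fact normr_is_norm : is_norm (fun x : H => `|x|).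
Proof. by split; [exact: ler_normD|exact: normrZ|exact: normr0_eq0]. Qed.

Fact normr_complete : norm_complete (fun x : H => `|x|).
Proof.
move=> u hu; have /cauchy_cvgP/cvg_ex[l /cvgrPdist_lt ul] : cauchy (u @ \oo).
  apply: cauchy_exP => e e0; have [n0 hn] := hu e e0; exists (u n0).
  exists n0 => // n /= n0n; rewrite -ball_normE /=; exact: hn.
exists l => e e0; have [n0 _ hn] := ul e e0; exists n0 => n n0n.
by rewrite distrC; exact: hn.
Qed.

Definition Hr : hilbert R := real_hilbert normr_is_norm inner_norm normr_complete.

Lemma Hr_nm (x : Hr) : (nm x)%:C%C = `|x : H|.
Proof. exact: real_nm. Qed.

Lemma Hr_ip (x y : Hr) : ip x y = complex.Re (inner x y).
Proof. by []. Qed.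

Lemma inner_iul x y : inner (iu R *: x) y = iu R * inner x y.
Proof. by rewrite linearZl_LR. Qed.

Lemma inner_iur x y : inner x (iu R *: y) = - (iu R * inner x y).
Proof. by rewrite linearZr_LR /= conj_iu mulNr. Qed.

Lemma dense_approx (G : set H) : dense G <->
  forall (v : Hr) e, 0 < e -> exists2 x : Hr, G x & nm (x - v) < e.
Proof.
split=> [Gd v e e0|Gd U [v Uv] Uo].
- have e0' : 0 < e%:C%C by rewrite ltcR.
  have [|x [Bx Gx]] := Gd (ball (v : H) e%:C%C) _ (ball_open _ _).
    by exists v; exact: ballxx.
  exists x => //; rewrite nmB -ltcR Hr_nm; move: Bx; rewrite -ball_normE; exact.
- have /nbhs_ballP[e e0 he] : nbhs v U by exact: open_nbhs_nbhs.
  have eE := ge0_real (ltW e0).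
  have [|x Gx hx] := Gd v (complex.Re e); first by rewrite -ltcR eE.
  exists x; split=> //; apply: he; rewrite -ball_normE /= -eE.
  by rewrite -(Hr_nm ((v : Hr) - x)) ltcR nmB.
Qed.

Implicit Types S T P : set (H * H).

Definition iu_stable S := forall x y, S (x, y) -> S (iu R *: x, iu R *: y).

(** Testing against (i x, i y) supplies the imaginary part of the adjoint identity. *)
Lemma op_adj_radj S : iu_stable S -> op_adj inner S = @radj R Hr S.
Proof.
move=> Si; rewrite eqEsubset; split=> [[u v] h x y Sxy|[u v] h x y Sxy].
  by rewrite !Hr_ip (h x y Sxy).
apply: re_inj; first exact: h _ _ Sxy.
by have := h _ _ (Si _ _ Sxy); rewrite !Hr_ip !inner_iul.
Qed.

Lemma op_adj_stable S : iu_stable (op_adj inner S).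
Proof. by move=> u v h x y /h /= k; rewrite !inner_iur k. Qed.

Lemma positive_selfadjointP S :
  positive_selfadjoint inner S <-> @psa R Hr S /\ iu_stable S.
Proof.
split=> [[Sd Sa S0]|[Sp Si]].
- have Si : iu_stable S by rewrite -Sa; exact: op_adj_stable.
  split=> //; split; first by rewrite -op_adj_radj.
    by move=> x y /S0; exact: re_ge0.
  move=> h hS; move/dense_approx: Sd => /dense_total; apply.
  by move=> x [y Sxy]; exact: hS Sxy.
- have Sa : op_adj inner S = S by rewrite op_adj_radj // (psa_adj Sp).
  split=> //.
    apply/dense_approx; apply: total_dense.
      split; first by exists 0; exact: (psa_lin Sp).1.
      move=> a x y [x' hx] [y' hy]; exists (a *: (x' : Hr) + (y' : Hr)).
      exact: (psa_lin Sp).2 _ _ _ hx hy.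
    by move=> h hS; apply: (psa_total Sp) => x y Sxy; apply: hS; exists y.
  (* The real statement gives the sign of Re <y, x>; complex self-adjointness makes <y, x> real. *)
  move=> x y Sxy; have := Sxy; rewrite -{1}Sa => /(_ _ _ Sxy) /= yx.
  have : Num.conj (inner y x) = inner y x by rewrite (dot_conj inner) -yx.
  have := psa_ge0 Sp Sxy; rewrite Hr_ip; case: (inner y x) => a b /= a0.
  move=> [/eqP]; rewrite eq_sym -subr_eq0 opprK -mulr2n mulrn_eq0 /= => /eqP ->.
  by rewrite lecE /= eqxx.
Qed.

Lemma op_sqrt_is_sqrt S : @psa R Hr S -> iu_stable S ->
  is_sqrt inner S (op_sqrt inner S).
Proof.
move=> Sp Si; have [P [Pp PP PC]] := psa_sqrt Sp.
suff h : is_sqrt inner S P by exact: (@xgetPex _ point (is_sqrt inner S) (ex_intro _ P h)).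
split=> //.
apply/positive_selfadjointP; split=> //.
(* Multiplication by i commutes with S, hence with the root P built from S. *)
move=> x y Pxy; apply: (PC (fun z : Hr => iu R *: (z : H))) => //.
- move=> a u v.
  rewrite -[LHS]/(iu R *: (a%:C%C *: (u : H) + (v : H))) scalerDr scalerA mulrC -scalerA.
  by [].
- by exists 1 => // z; rewrite mul1r nm_iu.
Qed.

Lemma op_abs_spec T : @closed_op R Hr T -> iu_stable T ->
  let S := op_abs inner T in let P := op_sqrt inner S in
  [/\ @psa R Hr S, @psa R Hr P, @rcomp R Hr S S = @rcomp R Hr (@radj R Hr T) T
    & @rcomp R Hr P P = S].
Proof.
move=> Tc Ti S P.
have Ap : @psa R Hr (op_comp (op_adj inner T) T).
  by rewrite (op_adj_radj Ti); exact: (von_neumann Tc).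
have Ai : iu_stable (op_comp (op_adj inner T) T).
  move=> x y [z h k]; exists (iu R *: z); first exact: Ti.
  exact: op_adj_stable.
have [/positive_selfadjointP[Sp Si] SS] := op_sqrt_is_sqrt Ap Ai.
have [/positive_selfadjointP[Pp Pi] PP] := op_sqrt_is_sqrt Sp Si.
by split=> //; rewrite -(op_adj_radj Ti).
Qed.

End ComplexRelations.

(** * Real parts of sesquilinear forms and antilinear functionals *)

Section SesquilinearForms.
Variables (R : realType) (V : lmodType R[i]) (c : {dot V for Num.conj}).
Variable N : V -> R[i].
Hypotheses (N_norm : is_norm N) (N_sq : forall x, N x ^+ 2 = c x x).
Hypothesis N_compl : norm_complete N.
Let Vr := real_hilbert N_norm N_sq N_compl.

Let Vr_nm (x : Vr) : (nm x)%:C%C = N x.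
Proof. exact: real_nm. Qed.

Lemma sesqui_iul (F : {sesquilinear V}) x y : F (iu R *: x) y = iu R * F x y.
Proof. by rewrite linearZl_LR. Qed.

Lemma sesqui_iur (F : {sesquilinear V}) x y : F x (iu R *: y) = - (iu R * F x y).
Proof. by rewrite linearZr_LR /= conj_iu mulNr. Qed.

Lemma re_sesqui_bounded (F : {sesquilinear V}) : bounded_form N F ->
  @bounded_bilin R Vr Vr (fun x y => complex.Re (F x y)).
Proof.
move=> [C C0 FC]; split=> [y a u v|x a u v|].
- by rewrite -[a *: u]/(a%:C%C *: (u : V)) linearDl linearZl_LR reD re_rM.
- rewrite -[a *: u]/(a%:C%C *: (u : V)) linearDr linearZr_LR reD /= conj_real.
  by rewrite re_rM.
- exists (complex.Re C) => [|x y]; first by rewrite re_ge0 // ltW.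
  rewrite -lecR !rmorphM /= (ge0_real (ltW C0)).
  rewrite !Vr_nm.
  exact: le_trans (norm_re _) (FC x y).
Qed.

Lemma antilinear_re_inj (f g : V -> R[i]) :
  (forall y, f (iu R *: y) = - (iu R * f y)) ->
  (forall y, g (iu R *: y) = - (iu R * g y)) ->
  (forall y, complex.Re (f y) = complex.Re (g y)) -> forall y, f y = g y.
Proof.
move=> fi gi fg y; apply: re_inj; first exact: fg.
by apply: oppr_inj; have := fg (iu R *: y); rewrite fi gi !raddfN.
Qed.

Lemma antilinear_iu (L : {antilinear V}) y : L (iu R *: y) = - (iu R * L y).
Proof. by rewrite linearZ_LR /= conj_iu mulNr. Qed.

Lemma re_antilinear (L : {antilinear V}) : bounded_functional N L ->
  (forall t (x y : Vr), complex.Re (L (t *: x + y)) =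
     t * complex.Re (L x) + complex.Re (L y)) /\
  exists C, forall x : Vr, `|complex.Re (L x)| <= C * nm x.
Proof.
move=> [C LC]; split=> [t x y|].
  by rewrite -[t *: x]/(t%:C%C *: (x : V)) linearD linearZ_LR reD /= conj_real re_rM.
have := ge0_real (normr_ge0 C); move: (complex.Re `|C|) => K KE.
exists K => x; rewrite -lecR rmorphM /= KE.
rewrite Vr_nm (le_trans (norm_re _)) //.
have Nx := is_norm_ge0 N_norm x.
have h0 : 0 <= C * N x by apply: le_trans (LC x).
by rewrite (le_trans (LC x)) // -{1}(ger0_norm h0) normrM (ger0_norm Nx).
Qed.

(** Antilinearity, L (i y) = - i L y, forces Im (L y) = l (i y). *)
Lemma complexify (l : Vr -> R) :
  (forall t x y, l (t *: x + y) = t * l x + l y) ->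
  (exists C, forall x, `|l x| <= C * nm x) ->
  exists2 L : {antilinear V}, bounded_functional N L
    & forall x, complex.Re (L x) = l x.
Proof.
move=> ll [C lC]; pose L (y : V) : R[i] := (l y +i* l (iu R *: y))%C.
have lD x y : l (x + y) = l x + l y by rewrite -(scale1r x) ll mul1r scale1r.
have lZ t x : l (t *: x) = t * l x.
  have l0 : l 0 = 0 by have := lD 0 0; rewrite addr0; lra.
  by rewrite -(addr0 (t *: x)) ll l0 addr0.
have Llin : linear_for (Num.conj \; *%R) L.
  move=> a u v; rewrite /L /=; apply/eqP.
  have aE w : a *: w = (complex.Re a)%:C%C *: w + (complex.Im a)%:C%C *: (iu R *: w).
    rewrite scalerA -scalerDl; congr (_ *: _); case: a => p q.
    by apply/eqP; rewrite eq_complex /= !mul0r !mulr0 mulr1 !subr0 !addr0 !add0r !eqxx.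
  have lC' (t : R) (w : V) : l (t%:C%C *: w) = t * l w by exact: lZ.
  have ii w : iu R *: (iu R *: w) = - w.
    rewrite scalerA -scaleN1r; congr (_ *: _).
    by apply/eqP; rewrite eq_complex /= !mul0r !mulr0 mulr1 sub0r addr0 oppr0 !eqxx.
  have lN w : l (- w) = - l w.
    by have := lZ (-1) w; rewrite scaleN1r mulN1r.
  have e1 : l (a *: u + v) = complex.Re a * l u + complex.Im a * l (iu R *: u) + l v.
    by rewrite lD aE lD !lC'.
  have e2 : l (iu R *: (a *: u + v)) =
      complex.Re a * l (iu R *: u) - complex.Im a * l u + l (iu R *: v).
    rewrite scalerDr lD; congr (_ + _).
    have -> : iu R *: (a *: u) = a *: (iu R *: u) by rewrite !scalerA mulrC.
    by rewrite aE ii lD !lC' lN mulrN.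
  rewrite eq_complex /= e1 e2; case: a {aE e1 e2} => p q /=.
  by apply/andP; split; apply/eqP; ring.
pose L' : {antilinear V} := HB.pack L (GRing.isLinear.Build _ _ _ _ L Llin).
exists L' => //; exists (2 * `|C|)%:C%C => x.
rewrite (le_trans (norm_le_parts _)) // -Vr_nm -rmorphM lecR /=.
have := lC x; have := lC (iu R *: (x : V)); rewrite nm_iu.
have : C * nm (x : Vr) <= `|C| * nm (x : Vr) by rewrite ler_wpM2r ?nm_ge0 ?ler_norm.
by rewrite -/Vr; lra.
Qed.

End SesquilinearForms.

(** * Solvable sesquilinear forms and their real counterparts *)

Section SolvableSesquilinearForm.
Variables (R : realType) (H : completeNormedModType R[i]).
Variable inner : {dot H for Num.conj}.
Hypothesis inner_norm : forall x : H, `|x| ^+ 2 = inner x x.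
Variables (D : submodClosed H) (N : subspace_of D -> R[i]).
Hypothesis D_dense : dense [set` D].
Variable ipN : {dot (subspace_of D) for Num.conj}.
Hypotheses (N_norm : is_norm N) (N_sq : forall x, N x ^+ 2 = ipN x x).
Hypothesis N_compl : norm_complete N.
Hypothesis N_dom : exists2 a, 0 < a & forall x : subspace_of D, `|val x| <= a * N x.

Let Hr := Hr inner_norm.
Let Er : hilbert R := real_hilbert N_norm N_sq N_compl.
Let iota (x : Er) : Hr := val (x : subspace_of D).

Let Er_nm (x : Er) : (nm x)%:C%C = N x.
Proof. exact: real_nm. Qed.

Let iota_lin : linear iota.
Proof.
move=> a x y; rewrite -[LHS]/(val (a%:C%C *: (x : subspace_of D) + y)).
by rewrite linearP.
Qed.

Let val_iu (x : subspace_of D) : val (iu R *: x) = iu R *: val x.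
Proof. exact: linearZ. Qed.

Let iota_bdd : bounded_op iota.
Proof.
have [a a0 ha] := N_dom; exists (complex.Re a) => [|x]; first by rewrite re_ge0 // ltW.
by rewrite -lecR rmorphM /= (ge0_real (ltW a0)) Er_nm Hr_nm.
Qed.

Let iota_inj x : iota x = 0 -> x = 0.
Proof. by move=> h; apply: val_inj; rewrite [LHS]h linear0. Qed.

Let iota_dense h : (forall x, ip (iota x) h = 0) -> h = 0.
Proof.
move=> hD; move/(dense_approx inner_norm): D_dense => /dense_total; apply=> x Dx.
exact: hD (exist _ x Dx : subspace_of D).
Qed.

Let range_iota : range iota = [set` D].
Proof.
rewrite eqEsubset; split=> [_ [x _ <-]|x Dx]; first exact: valP (x : subspace_of D).
by exists (exist _ x Dx : subspace_of D).
Qed.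

Implicit Types (F : {sesquilinear (subspace_of D)}) (U : {sesquilinear H}).

Definition re_form F (x y : Er) : R := complex.Re (F x y).
Definition re_perturbation U (x y : Hr) : R := complex.Re (U x y).

Lemma associated_opE F : associated_op inner F = assoc iota (re_form F).
Proof.
rewrite eqEsubset; split=> [[x y] [e /= <- h]|[x y] [e /= <- h]]; exists e => // z.
  by rewrite /re_form h.
apply: (@antilinear_re_inj _ _ (fun z => F e z) (fun z => inner y (val z))) => {}z.
- exact: sesqui_iur.
- by rewrite val_iu inner_iur.
- exact: h.
Qed.

Lemma associated_op_stable F : iu_stable (associated_op inner F).
Proof.
move=> x y [e /= <- h]; exists (iu R *: e); first by rewrite val_iu.
by move=> z; rewrite sesqui_iul h inner_iul.
Qed.

Lemma perturbation_bounded F U : perturbations F N U ->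
  @bounded_bilin R Hr Hr (re_perturbation U).
Proof. by move=> [Ub _ _]; exact: re_sesqui_bounded. Qed.

Let sum_iu F U x y : F x (iu R *: y) + U (val x) (val (iu R *: y)) =
  - (iu R * (F x y + U (val x) (val y))).
Proof. by rewrite val_iu !sesqui_iur mulrDr opprD. Qed.

Lemma perturbation_solvable F U : bounded_form N F -> perturbations F N U ->
  solvable_form (fun x y => re_form F x y + re_perturbation U (iota x) (iota y)).
Proof.
move=> Fb FU; have [Ub Ui Us] := FU.
split.
- have [f1 f2 [C C0 fC]] := re_sesqui_bounded N_norm N_sq N_compl Fb.
  have [u1 u2 [M M0 uM]] := perturbation_bounded FU; have [K K0 iK] := iota_bdd.
  split=> [y a x x'|x a y y'|].
  + by rewrite /re_form f1 iota_lin u1; ring.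
  + by rewrite /re_form f2 iota_lin u2; ring.
  exists (C + M * K ^+ 2) => [|x y]; first by rewrite addr_ge0 // mulr_ge0 // exprn_ge0.
  apply: (le_trans (ler_normD _ _)); rewrite !mulrDl; apply: lerD; first exact: fC.
  apply: (le_trans (uM _ _)).
  have -> : M * K ^+ 2 * nm x * nm y = M * ((K * nm x) * (K * nm y)) by ring.
  by rewrite -mulrA ler_wpM2l // ler_pM ?nm_ge0.
- move=> x hx; apply: Ui.
  apply: (@antilinear_re_inj _ _ (fun y => F x y + U (val x) (val y)) (fun=> 0)) => y.
  + exact: sum_iu.
  + by rewrite mulr0 oppr0.
  + by rewrite reD; exact: hx.
- move=> l ll lb; have [L Lb Ll] := complexify ll lb.
  have [x hx] := Us L Lb; exists x => y.
  by rewrite -Ll hx reD.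
Qed.

(** The adjoint form of U serves as perturbation: the real part of the adjoint sum is the swapped
    real form, to which [solvable_swap] applies. *)
Lemma adjoint_solvable F : solvable_wrt F N -> solvable_wrt (adjoint_form F) N.
Proof.
move=> [[h1 h2 Fb] [U FU]]; split.
  split=> //; case: Fb => C C0 FC; exists C => // x y.
  by rewrite norm_conjC mulrAC.
have sw := solvable_swap (perturbation_solvable Fb FU); have [Ub _ _] := FU.
have sum_iu' x y : adjoint_form F x (iu R *: y) + adjoint_form U (val x) (val (iu R *: y)) =
    - (iu R * (adjoint_form F x y + adjoint_form U (val x) (val y))) by exact: sum_iu.
exists (adjoint_form U); split.
- by case: Ub => C C0 UC; exists C => // x y; rewrite norm_conjC mulrAC.
- move=> x hx; apply: (solvable_inj sw) => y.
  by have := congr1 (@complex.Re R) (hx y); rewrite reD !re_conj.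
- move=> L Lb; have [ll lb] := re_antilinear N_norm N_sq N_compl Lb.
  have [x hx] := solvable_surj sw ll lb; exists x.
  apply: antilinear_re_inj => y; first exact: antilinear_iu.
  + exact: sum_iu'.
  + by rewrite hx reD !re_conj.
Qed.

Section Transfer.
Variable F : {sesquilinear (subspace_of D)}.
Hypothesis F_solvable : solvable_wrt F N.
Let T := associated_op inner F.

Lemma associated_op_closed : @closed_op R Hr T.
Proof.
have [[_ _ Fb] [U FU]] := F_solvable; rewrite /T associated_opE.
exact: assoc_closed (perturbation_bounded FU) (perturbation_solvable Fb FU).
Qed.

Lemma associated_op_adjoint : associated_op inner (adjoint_form F) = op_adj inner T.
Proof.
have [[_ _ Fb] [U FU]] := F_solvable.
rewrite (op_adj_radj inner_norm (@associated_op_stable F)) /T !associated_opE.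
rewrite (assoc_adj _ _ _ _ (perturbation_bounded FU) (perturbation_solvable Fb FU)) //.
suff -> : re_form (adjoint_form F) = (fun x y => re_form F y x) by [].
by apply/funext => x; apply/funext => y; exact: re_conj.
Qed.

Lemma associated_op_biadjoint : op_adj inner (op_adj inner T) = T.
Proof.
rewrite (op_adj_radj inner_norm (@op_adj_stable _ _ inner T)).
rewrite (op_adj_radj inner_norm (@associated_op_stable F)).
exact: closed_adj associated_op_closed.
Qed.

Let DT := dom (op_sqrt inner (op_abs inner T)).
Let DTadj := dom (op_sqrt inner (op_abs inner (op_adj inner T))).

Lemma abs_sqrt_domain_transfer :
  (DT `<=` [set` D] -> [set` D] `<=` DTadj) /\ ([set` D] `<=` DT -> DTadj `<=` [set` D]).
Proof.
have [[_ _ Fb] [U FU]] := F_solvable; have Ti := @associated_op_stable F.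
have Tc := associated_op_closed; have adjE := op_adj_radj inner_norm Ti.
have [Sp Pp SS PP] := op_abs_spec Tc Ti.
have Tsc : @closed_op R Hr (op_adj inner T) by rewrite adjE; exact: closed_op_adj.
have [Ssp Psp SsSs PsPs] := op_abs_spec Tsc (@op_adj_stable _ _ inner T).
rewrite -range_iota.
apply: (sqrt_domain_transfer iota_lin iota_bdd iota_inj iota_dense
  (perturbation_bounded FU) (perturbation_solvable Fb FU) Sp Pp _ PP Ssp Psp _ PsPs).
- by rewrite SS /T associated_opE.
- by rewrite SsSs adjE (closed_adj Tc) /T associated_opE.
Qed.

End Transfer.

End SolvableSesquilinearForm.

Theorem lemma4p14 (R : realType) (H : completeNormedModType R[i])
    (inner : {dot H for Num.conj})
    (inner_norm : forall x : H, `|x| ^+ 2 = inner x x)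
    (D : submodClosed H) (D_dense : dense [set` D])
    (Omega : {sesquilinear (subspace_of D)}) (N : subspace_of D -> R[i])
    (N_hilbert : hilbert_norm N) (Omega_solvable : solvable_wrt Omega N) :
  let T := associated_op inner Omega in
  let DT := dom (op_sqrt inner (op_abs inner T)) in
  let DTadj := dom (op_sqrt inner (op_abs inner (op_adj inner T))) in
  [<-> [set` D] = DT;
       hyper_solvable inner Omega;
       [set` D] `<=` DT `&` DTadj;
       DT `|` DTadj `<=` [set` D];
       [set` D] = DTadj;
       hyper_solvable inner (adjoint_form Omega)].
Proof.
move=> T DT DTadj; have [N_norm [ipN N_sq]] := N_hilbert.
have [[N_dom [_ N_compl _] _] _] := Omega_solvable.
have adj_solvable := adjoint_solvable inner_norm N_norm N_sq N_compl N_dom Omega_solvable.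
have TadjE : associated_op inner (adjoint_form Omega) = op_adj inner T.
  exact: (associated_op_adjoint inner_norm D_dense N_norm N_sq N_compl).
have [a b] : (DT `<=` [set` D] -> [set` D] `<=` DTadj) /\
             ([set` D] `<=` DT -> DTadj `<=` [set` D]).
  exact: (abs_sqrt_domain_transfer inner_norm D_dense N_norm N_sq N_compl).
(* The adjoint form has operator T', and T'' = T, so the implications hold with T and T'
   exchanged. *)
have [a' b'] : (DTadj `<=` [set` D] -> [set` D] `<=` DT) /\
                ([set` D] `<=` DTadj -> DT `<=` [set` D]).
  have := abs_sqrt_domain_transfer inner_norm D_dense N_norm N_sq N_compl N_dom adj_solvable.
  rewrite /= TadjE.
  by rewrite (associated_op_biadjoint inner_norm D_dense N_norm N_sq N_compl).
tfae.
- by move=> DE; split; [exists N|].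
- by move=> [_ DE]; rewrite subsetI; split; [rewrite {1}DE|apply: a; rewrite DE].
- by rewrite subsetI subUset => -[h1 h2]; split; [exact: b'|exact: b].
- by rewrite subUset => -[h1 h2]; rewrite eqEsubset; split=> //; exact: a.
- by move=> DE; split; [exists N|rewrite TadjE].
- move=> [_]; rewrite TadjE => DE; rewrite eqEsubset.
  by split; [apply: a'; rewrite DE|apply: b'; rewrite {1}DE].
Qed.
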